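(* Let $b>0$ and let $f\in C^2[-b,b]$ be complex-valued with $f(x)\ne0$ on $[-b,b]$ and $f(0)=1$. Let $\mathbf{R}=(-b,b)\times(-b,b)$ and $\overline{\mathbf{R}}=[-b,b]\times[-b,b]$, and let $W$ be a $\mathbb{B}$-valued solution in $\mathbf{R}$ of the hyperbolic Vekua equation $$\partial_{\bar z}W-\frac{f'(x)}{2f(x)}\overline W=0 .$$ Then there exists a sequence of polynomials in formal powers $P_N=\sum_{n=0}^NZ^{(n)}(a_n,0;z)$ (with coefficients $a_n\in\mathbb{B}$ that may depend on the polynomial) uniformly convergent to $W$ in $\overline{\mathbf{R}}$.
   Context: $\mathbb{B}=\{w=u+v\mathbf{j}:u,v\in\mathbb{C}\}$ is the commutative algebra of bicomplex numbers, $\mathbf{j}^2=1$, the complex unit $\mathbf{i}$ commuting with $\mathbf{j}$; $\overline w=u-v\mathbf{j}$; $|w|=\frac12(|u+v|+|u-v|)$. The variable is $z=x+t\mathbf{j}$ with $x,t\in\mathbb{R}$, identified with the point $(x,t)$; $\partial_{\bar z}=\frac12(\partial_x-\mathbf{j}\partial_t)$. Set $X^{(0)}\equiv\widetilde X^{(0)}\equiv1$ and, for $n\ge1$, $$X^{(n)}(x)=n\int_0^xX^{(n-1)}(s)\bigl(f^2(s)\bigr)^{(-1)^n}ds,\qquad \widetilde X^{(n)}(x)=n\int_0^x\widetilde X^{(n-1)}(s)\bigl(f^2(s)\bigr)^{(-1)^{n-1}}ds.$$ Let $\varphi_k=fX^{(k)}$, $\psi_k=\widetilde X^{(k)}/f$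 for odd $k$ and $\varphi_k=f\widetilde X^{(k)}$, $\psi_k=X^{(k)}/f$ for even $k$. Put $u_0=\varphi_0(x)$, $v_0=\psi_0(x)$ and, for $m\ge1$, $$u_{2m-1}(x,t)=\sum_{\text{even }k=0}^m\binom mk\varphi_{m-k}(x)t^k,\qquad u_{2m}(x,t)=\sum_{\text{odd }k=1}^m\binom mk\varphi_{m-k}(x)t^k,$$ $$v_{2m-1}(x,t)=\sum_{\text{even }k=0}^m\binom mk\psi_{m-k}(x)t^k,\qquad v_{2m}(x,t)=\sum_{\text{odd }k=1}^m\binom mk\psi_{m-k}(x)t^k.$$ The formal powers with center $0$ and coefficient $a=a'+\mathbf{j}a''$ ($a',a''\in\mathbb{C}$) are $Z^{(0)}(a,0;z)=a'u_0(x,t)+\mathbf{j}a''v_0(x,t)$ and, for $n\ge1$, $$Z^{(n)}(a,0;z)=a'u_{2n-1}(x,t)+a''u_{2n}(x,t)+\mathbf{j}\bigl(a'v_{2n}(x,t)+a''v_{2n-1}(x,t)\bigr).$$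
   Formalization: W is additionally assumed to be defined and continuous on the closed square, which uniform convergence there forces; without it the claim fails, e.g. f=1 and W=(1+j)/(2(2b-x-t)), unbounded at the corner (b,b). ''Solution'' is read as C^1 in the open square. *)

(* Defs.v *)
From Stdlib Require Import Reals Arith.
From Coquelicot Require Import Coquelicot.

Open Scope R_scope.

(** * Bicomplex numbers *)

(* The pair (u, v) is u + v j.  As a product type, B inherits the componentwise
   additive group and the product uniform structure. *)
Definition B : Type := (C * C)%type.

(* B as a real normed space, used for derivatives with respect to the real
   variables x and t. *)
Definition B_R_NormedModule : NormedModule R_AbsRing :=
  prod_NormedModule R_AbsRing C_R_NormedModule C_R_NormedModule.

Definition CtoB (c : C) : B := (c, RtoC 0).

Definition Bj : B := (RtoC 0, RtoC 1).

Definition Bminus (w w' : B) : B :=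
  (fst w - fst w', snd w - snd w')%C.

(* j ^ 2 = 1, and i commutes with j. *)
Definition Bmult (w w' : B) : B :=
  (fst w * fst w' + snd w * snd w', fst w * snd w' + snd w * fst w')%C.

Definition Bconj (w : B) : B := (fst w, - snd w)%C.

Definition Bnorm (w : B) : R :=
  / 2 * (Cmod (fst w + snd w) + Cmod (fst w - snd w)).

(** * Functions of class C^2 on a compact interval *)

(* Derivative at x of a complex-valued function along D: one-sided at the
   endpoints when D is a closed interval, and [is_derive] at interior points. *)
Definition is_derive_within (D : R -> Prop) (f : R -> C) (x : R) (l : C) : Prop :=
  filterdiff (U := R_NormedModule) (V := C_R_NormedModule)
    f (within D (locally x)) (fun h => scal h l).

Definition seg (b x : R) : Prop := - b <= x <= b.

(* f is in C^2[-b, b], with first and second derivatives f' and f''. *)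
Definition C2_seg (b : R) (f f' f'' : R -> C) : Prop :=
  (forall x, seg b x -> is_derive_within (seg b) f x (f' x)) /\
  (forall x, seg b x -> is_derive_within (seg b) f' x (f'' x)) /\
  continuous_on (seg b) f''.

(** * The hyperbolic Vekua equation *)

(* The variable z = x + t j is the point (x, t). *)
Definition open_square (b : R) (z : R * R) : Prop :=
  - b < fst z < b /\ - b < snd z < b.

Definition closed_square (b : R) (z : R * R) : Prop :=
  - b <= fst z <= b /\ - b <= snd z <= b.

(* W is of class C^1 on the open set D, with partial derivatives Wx and Wt. *)
Definition C1_dom (D : R * R -> Prop) (W Wx Wt : R * R -> B) : Prop :=
  (forall x t, D (x, t) ->
     is_derive (V := B_R_NormedModule) (fun s => W (s, t)) x (Wx (x, t)) /\
     is_derive (V := B_R_NormedModule) (fun s => W (x, s)) t (Wt (x, t))) /\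
  continuous_on D Wx /\ continuous_on D Wt.

(* The operator d/d(zbar) = (d/dx - j d/dt) / 2. *)
Definition dzbar (Wx Wt : R * R -> B) (z : R * R) : B :=
  Bmult (CtoB (/ RtoC 2)) (Bminus (Wx z) (Bmult Bj (Wt z))).

Definition vekua_solution (f f' : R -> C) (D : R * R -> Prop) (W : R * R -> B)
  : Prop :=
  exists Wx Wt : R * R -> B,
    C1_dom D W Wx Wt /\
    forall z, D z ->
      Bminus (dzbar Wx Wt z)
        (Bmult (CtoB (f' (fst z) / (RtoC 2 * f (fst z)))%C) (Bconj (W z)))
      = CtoB (RtoC 0).

(** * Formal powers *)

(* w ^ ((-1) ^ n) *)
Definition Csignpow (w : C) (n : nat) : C :=
  if Nat.even n then w else (/ w)%C.

Fixpoint X (f : R -> C) (n : nat) (x : R) : C :=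
  match n with
  | O => RtoC 1
  | S m => (RtoC (INR n) *
      RInt (V := C_R_CompleteNormedModule)
        (fun s => X f m s * Csignpow (f s * f s) n) 0 x)%C
  end.

Fixpoint Xt (f : R -> C) (n : nat) (x : R) : C :=
  match n with
  | O => RtoC 1
  | S m => (RtoC (INR n) *
      RInt (V := C_R_CompleteNormedModule)
        (fun s => Xt f m s * Csignpow (f s * f s) m) 0 x)%C
  end.

Definition phi (f : R -> C) (k : nat) (x : R) : C :=
  if Nat.odd k then (f x * X f k x)%C else (f x * Xt f k x)%C.

Definition psi (f : R -> C) (k : nat) (x : R) : C :=
  if Nat.odd k then (Xt f k x / f x)%C else (X f k x / f x)%C.

(* For g = phi this is the sequence u_n, for g = psi the sequence v_n.  The
   index n >= 1 is 2 m - 1 or 2 m with m = div2 (n + 1); the sum runs over the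
   k <= m that are even when n = 2 m - 1 and odd when n = 2 m. *)
Definition wave (g : nat -> R -> C) (n : nat) (x t : R) : C :=
  match n with
  | O => g O x
  | S _ =>
      let m := Nat.div2 (S n) in
      sum_n (fun k =>
        if Bool.eqb (Nat.even k) (Nat.odd n)
        then (RtoC (Binomial.C m k) * g (m - k)%nat x * RtoC (t ^ k))%C
        else RtoC 0) m
  end.

Definition u_ (f : R -> C) : nat -> R -> R -> C := wave (phi f).
Definition v_ (f : R -> C) : nat -> R -> R -> C := wave (psi f).

(* The formal power Z^(n)(a, 0; z) with z = x + t j and a = a' + j a''. *)
Definition Zformal (f : R -> C) (n : nat) (a : B) (z : R * R) : B :=
  let (a', a'') := a in
  let (x, t) := z in
  match n with
  | O => (a' * u_ f 0 x t, a'' * v_ f 0 x t)%C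
  | S _ =>
      (a' * u_ f (2 * n - 1)%nat x t + a'' * u_ f (2 * n)%nat x t,
       a' * v_ f (2 * n)%nat x t + a'' * v_ f (2 * n - 1)%nat x t)%C
  end.

(* The polynomial in formal powers with coefficients a 0, ..., a N. *)
Definition Zpoly (f : R -> C) (a : nat -> B) (N : nat) (z : R * R) : B :=
  sum_n (G := prod_AbelianMonoid C_AbelianMonoid C_AbelianMonoid)
    (fun n => Zformal f n (a n) z) N.

(* Main.v *)
Require Import Defs.
From Stdlib Require Import Reals.
From Coquelicot Require Import Coquelicot.
From Stdlib Require Import Lra Lia Classical IndefiniteDescription FunctionalExtensionality.

Open Scope R_scope.
Set Bullet Behavior "Strict Subproofs".

(** Write W = u + v j.  The equation says that u_x - v_t = g u and
    v_x - u_t = - g v with g = f'/f, so alpha = u + v and beta = u - v satisfy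
    alpha_x - alpha_t = g beta and beta_x + beta_t = g alpha.  In the
    characteristic coordinates y and z, equal to x + t and x - t for alpha and
    to x - t and x + t for beta, both equations take the same form
<<
      d/dz V_i(y, z) = G(y + z) V_(not i)(z, y),     G(r) = f'(r/2) / (2 f(r/2)),
>>
    that is, a linear Volterra equation along each characteristic
    ([vekua_integral_equation]).  The square becomes |y| + |z| <= 2b.

    At x = 0, that is on the line z = - y, the formal power Z^(n)(a) has the
    value j^n a t^n.  Hence polynomials in formal powers are the solutions
    whose values on x = 0 are polynomials in t ([vekua_Zpoly] and
    [Zpoly_cauchy_data]).  By Weierstrass such data are dense, and the Cauchy
    problem on x = 0 is stable in the uniform norm ([cauchy_stability]).  The
    difficulty is that the values of W at x = 0 are known for |t| <= b only
    and determine W just on the diamond |x| + |t| <= b.  To control the whole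
    square one needs data for |t| <= 2b, so W has to be continued.

    The continuation uses the other natural problem.  W is determined on the
    square by the values of alpha on one diagonal and of beta on the other,
    i.e. by V_i(y, 0) for |y| <= 2b.  This Goursat problem is solved by the
    Neumann series on the whole box |y|, |z| <= 2b, which contains the line
    z = - y for |y| <= 2b.  It involves G(r) for |r| > 2b as well, where
    f and f' are replaced by their values at the nearest endpoint.  The role of
    the continuation is played by a partial sum S of the series, which solves the
    equation on the box up to a small error and is close to W on the square
    ([approximate_goursat_extension]).

    Both stability statements are instances of [volterra_stability]: in the norm
    weighted by exp(-2Kw), where |G| <= K and w measures the distance to the
    line carrying the data, the integral operator is a contraction of ratio 1/2.
    Finally P_N is the polynomial whose data on x = 0 come from the Bernstein
    polynomials of degree N of the data of S.  Since S depends on the accuracy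
    wanted, a diagonal choice ([diagonal_choice]) produces a single sequence. *)

(** * Continuity of complex-valued functions *)

Lemma continuous_Cpair {U : UniformSpace} (p q : U -> R) (x : U) :
  continuous p x -> continuous q x -> continuous (fun u => (p u, q u) : C) x.
Proof.
  intros hp hq.
  apply (continuous_comp_2 p q (fun a b => (a, b) : C)); trivial.
  apply (continuous_ext (fun u : R * R => u)). now intros [? ?].
  apply continuous_id.
Qed.

Lemma continuous_Re {U : UniformSpace} (p : U -> C) (x : U) :
  continuous p x -> continuous (fun u => fst (p u)) x.
Proof. intros hp. apply (continuous_comp p fst); trivial. destruct (p x). apply continuous_fst. Qed.

Lemma continuous_Im {U : UniformSpace} (p : U -> C) (x : U) :
  continuous p x -> continuous (fun u => snd (p u)) x.
Proof. intros hp. apply (continuous_comp p snd); trivial. destruct (p x). apply continuous_snd. Qed.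

Lemma continuous_Cplus {U : UniformSpace} (p q : U -> C) (x : U) :
  continuous p x -> continuous q x -> continuous (fun u => p u + q u)%C x.
Proof. intros hp hq. apply (continuous_plus (V := C_R_NormedModule) p q); trivial. Qed.

Lemma continuous_Cminus {U : UniformSpace} (p q : U -> C) (x : U) :
  continuous p x -> continuous q x -> continuous (fun u => p u - q u)%C x.
Proof. intros hp hq. apply (continuous_minus (V := C_R_NormedModule) p q); trivial. Qed.

Lemma continuous_Cmult {U : UniformSpace} (p q : U -> C) (x : U) :
  continuous p x -> continuous q x -> continuous (fun u => p u * q u)%C x.
Proof.
  intros hp hq.
  apply continuous_Cpair.
  - apply (continuous_minus (V := R_NormedModule) (fun u => fst (p u) * fst (q u)) (fun u => snd (p u) * snd (q u)));
    apply (continuous_mult (K := R_AbsRing)); (apply continuous_Re || apply continuous_Im); trivial.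
  - apply (continuous_plus (V := R_NormedModule) (fun u => fst (p u) * snd (q u)) (fun u => snd (p u) * fst (q u)));
    apply (continuous_mult (K := R_AbsRing)); (apply continuous_Re || apply continuous_Im); trivial.
Qed.

Lemma continuous_RtoC {U : UniformSpace} (p : U -> R) (x : U) :
  continuous p x -> continuous (fun u => RtoC (p u)) x.
Proof. intros hp. apply continuous_Cpair; trivial. apply continuous_const. Qed.

Lemma Csqmod_neq0 (c : C) : c <> RtoC 0 -> fst c ^ 2 + snd c ^ 2 <> 0.
Proof.
  intros hc h. apply hc. apply injective_projections; simpl; nra.
Qed.

Lemma continuous_Cinv {U : UniformSpace} (p : U -> C) (x : U) :
  continuous p x -> p x <> RtoC 0 -> continuous (fun u => / p u)%C x.
Proof.
  intros hp hpx. apply Csqmod_neq0 in hpx.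
  assert (hn : continuous (fun u => fst (p u) ^ 2 + snd (p u) ^ 2) x).
  { apply (continuous_plus (V := R_NormedModule) (fun u => fst (p u) ^ 2) (fun u => snd (p u) ^ 2)).
    - apply (continuous_comp (fun u => fst (p u)) (fun r => r ^ 2)); [now apply continuous_Re|].
      apply (ex_derive_continuous (fun r => r ^ 2)). auto_derive. easy.
    - apply (continuous_comp (fun u => snd (p u)) (fun r => r ^ 2)); [now apply continuous_Im|].
      apply (ex_derive_continuous (fun r => r ^ 2)). auto_derive. easy. }
  assert (hi : continuous (fun u => / (fst (p u) ^ 2 + snd (p u) ^ 2)) x).
  { apply (continuous_comp _ Rinv); trivial. now apply continuous_Rinv. }
  apply continuous_Cpair.
  - apply (continuous_mult (K := R_AbsRing)); [now apply continuous_Re | apply hi].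
  - apply (continuous_mult (K := R_AbsRing)); [|apply hi].
    apply (continuous_opp (V := R_NormedModule)). now apply continuous_Im.
Qed.

Lemma continuous_Bpair {U : UniformSpace} (p q : U -> C) (x : U) :
  continuous p x -> continuous q x ->
  continuous (U := prod_UniformSpace C_UniformSpace C_UniformSpace) (fun u => (p u, q u)) x.
Proof.
  intros hp hq.
  apply (continuous_comp_2 p q (fun a b => (a, b)) x hp hq).
  apply (continuous_ext (fun u : C * C => u)); [now intros [? ?]|]. apply continuous_id.
Qed.

Lemma continuous_Bfst {T : UniformSpace} (W : T -> B) (x : T) :
  continuous (U := prod_UniformSpace C_UniformSpace C_UniformSpace) W x ->
  continuous (fun u => fst (W u)) x.
Proof. intros hW. apply (continuous_comp W fst); trivial. destruct (W x). apply continuous_fst. Qed.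

Lemma continuous_Bsnd {T : UniformSpace} (W : T -> B) (x : T) :
  continuous (U := prod_UniformSpace C_UniformSpace C_UniformSpace) W x ->
  continuous (fun u => snd (W u)) x.
Proof. intros hW. apply (continuous_comp W snd); trivial. destruct (W x). apply continuous_snd. Qed.

Lemma norm_Cmod (c : C) : norm (V := C_R_NormedModule) c = Cmod c.
Proof.
  change (sqrt (Rabs (fst c) ^ 2 + Rabs (snd c) ^ 2) = sqrt (fst c ^ 2 + snd c ^ 2)).
  now rewrite !pow2_abs.
Qed.

Lemma continuous_C_iff {U : UniformSpace} (h : U -> C) (x : U) :
  continuous h x <->
  forall eps : posreal, locally x (fun u => Cmod (h u - h x)%C < eps).
Proof.
  split.
  - intros hh eps.
    generalize (proj1 (filterlim_locally_ball_norm (U := C_R_NormedModule) h (h x)) hh eps).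
    apply filter_imp. intros u hu. unfold ball_norm in hu. now rewrite norm_Cmod in hu.
  - intros hh. apply (proj2 (filterlim_locally_ball_norm (U := C_R_NormedModule) h (h x))).
    intros eps. generalize (hh eps). apply filter_imp.
    intros u hu. unfold ball_norm. now rewrite norm_Cmod.
Qed.

(** Composing with a retraction onto D turns continuity on D, which is one-sided at
    the boundary, into continuity everywhere. *)
Lemma continuous_on_retract {U V T : UniformSpace} (D : U -> Prop) (h : U -> V) (r : T -> U) (x : T) :
  continuous_on D h -> (forall u, D (r u)) -> continuous r x -> continuous (fun u => h (r u)) x.
Proof.
  intros hh hr hrx.
  refine (filterlim_comp T U V r h (locally x) (within D (locally (r x))) (locally (h (r x))) _ (hh _ (hr x))).
  intros P hP. unfold filtermap.
  generalize (hrx (fun u => D u -> P u) hP). unfold filtermap. apply filter_imp. intros u hu. now apply hu.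
Qed.

(** * Derivatives of complex-valued functions *)

Lemma is_derive_fst {U V : NormedModule R_AbsRing} (F : R -> prod_NormedModule R_AbsRing U V) (x : R)
  (l : prod_NormedModule R_AbsRing U V) :
  is_derive F x l -> is_derive (fun s => fst (F s)) x (fst l).
Proof.
  intros hF.
  apply (filterdiff_ext_lin (fun s => fst (F s)) (fun h => fst (scal h l))); [|easy].
  apply (filterdiff_comp' F fst x _ fst hF).
  apply filterdiff_linear, is_linear_fst.
Qed.

Lemma is_derive_snd {U V : NormedModule R_AbsRing} (F : R -> prod_NormedModule R_AbsRing U V) (x : R)
  (l : prod_NormedModule R_AbsRing U V) :
  is_derive F x l -> is_derive (fun s => snd (F s)) x (snd l).
Proof.
  intros hF.
  apply (filterdiff_ext_lin (fun s => snd (F s)) (fun h => snd (scal h l))); [|easy].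
  apply (filterdiff_comp' F snd x _ snd hF).
  apply filterdiff_linear, is_linear_snd.
Qed.

Lemma is_derive_pair {U V : NormedModule R_AbsRing} (p : R -> U) (q : R -> V) (x : R) (l : U) (m : V) :
  is_derive p x l -> is_derive q x m ->
  is_derive (V := prod_NormedModule R_AbsRing U V) (fun s => (p s, q s)) x (l, m).
Proof.
  intros hp hq.
  apply (filterdiff_ext_lin (fun s => (p s, q s)) (fun h => (scal h l, scal h m))); [|easy].
  apply (filterdiff_comp'_2 p q (fun a b => (a, b) : prod_NormedModule R_AbsRing U V) x
    (fun h => scal h l) (fun h => scal h m) (fun a b => (a, b)) hp hq).
  apply (filterdiff_ext_lin (fun t => (fst t, snd t)) (fun t => t)); [|now intros [? ?]].
  apply (filterdiff_ext (fun t => t)); [now intros [? ?]|].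
  apply filterdiff_id.
Qed.

Lemma is_derive_Cpair (p q : R -> R) (x l m : R) :
  is_derive p x l -> is_derive q x m ->
  is_derive (V := C_R_NormedModule) (fun s => (p s, q s)) x (l, m).
Proof. apply (is_derive_pair (U := R_NormedModule) (V := R_NormedModule)). Qed.

Lemma is_derive_Re (F : R -> C) (x : R) (l : C) :
  is_derive (V := C_R_NormedModule) F x l -> is_derive (fun s => fst (F s)) x (fst l).
Proof. apply (is_derive_fst (U := R_NormedModule) (V := R_NormedModule)). Qed.

Lemma is_derive_Im (F : R -> C) (x : R) (l : C) :
  is_derive (V := C_R_NormedModule) F x l -> is_derive (fun s => snd (F s)) x (snd l).
Proof. apply (is_derive_snd (U := R_NormedModule) (V := R_NormedModule)). Qed.

Lemma is_derive_Cplus (p q : R -> C) (x : R) (l m : C) :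
  is_derive (V := C_R_NormedModule) p x l -> is_derive (V := C_R_NormedModule) q x m ->
  is_derive (V := C_R_NormedModule) (fun s => p s + q s)%C x (l + m)%C.
Proof. apply (is_derive_plus (V := C_R_NormedModule)). Qed.

Lemma is_derive_Cmult (p q : R -> C) (x : R) (l m : C) :
  is_derive (V := C_R_NormedModule) p x l -> is_derive (V := C_R_NormedModule) q x m ->
  is_derive (V := C_R_NormedModule) (fun s => p s * q s)%C x (l * q x + p x * m)%C.
Proof.
  intros hp hq.
  pose proof (is_derive_Re _ _ _ hp) as h1. pose proof (is_derive_Im _ _ _ hp) as h2.
  pose proof (is_derive_Re _ _ _ hq) as h3. pose proof (is_derive_Im _ _ _ hq) as h4.
  replace (l * q x + p x * m)%C with
   ((fst l * fst (q x) + fst (p x) * fst m) - (snd l * snd (q x) + snd (p x) * snd m),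
    (fst l * snd (q x) + fst (p x) * snd m) + (snd l * fst (q x) + snd (p x) * fst m)).
  2:{ apply injective_projections; simpl; ring. }
  apply is_derive_Cpair.
  - apply (is_derive_minus (V := R_NormedModule) (fun s => fst (p s) * fst (q s)) (fun s => snd (p s) * snd (q s)));
      apply (is_derive_mult (K := R_AbsRing)); trivial; exact Rmult_comm.
  - apply (is_derive_plus (V := R_NormedModule) (fun s => fst (p s) * snd (q s)) (fun s => snd (p s) * fst (q s)));
      apply (is_derive_mult (K := R_AbsRing)); trivial; exact Rmult_comm.
Qed.

Lemma is_derive_Cconst (c : C) (x : R) :
  is_derive (V := C_R_NormedModule) (fun _ => c) x (RtoC 0).
Proof. apply (is_derive_const (V := C_R_NormedModule)). Qed.

Lemma is_derive_Cscal (c : C) (p : R -> C) (x : R) (l : C) :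
  is_derive (V := C_R_NormedModule) p x l ->
  is_derive (V := C_R_NormedModule) (fun s => c * p s)%C x (c * l)%C.
Proof.
  intros hp. replace (c * l)%C with (RtoC 0 * p x + c * l)%C by ring.
  apply (is_derive_Cmult (fun _ => c) p); trivial. apply is_derive_Cconst.
Qed.

Lemma is_derive_Cinv (p : R -> C) (x : R) (l : C) :
  is_derive (V := C_R_NormedModule) p x l -> p x <> RtoC 0 ->
  is_derive (V := C_R_NormedModule) (fun s => / p s)%C x (- l / (p x * p x))%C.
Proof.
  intros hp hpx. pose proof (Csqmod_neq0 _ hpx) as hn.
  pose proof (is_derive_Re _ _ _ hp) as h1. pose proof (is_derive_Im _ _ _ hp) as h2.
  set (n := fun s => fst (p s) ^ 2 + snd (p s) ^ 2).
  assert (hd : is_derive n x (2 * fst l * fst (p x) + 2 * snd l * snd (p x))).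
  { replace (2 * fst l * fst (p x) + 2 * snd l * snd (p x)) with
      (plus (INR 2 * fst l * fst (p x) ^ 1) (INR 2 * snd l * snd (p x) ^ 1))
      by (unfold plus; simpl; ring).
    apply (is_derive_plus (V := R_NormedModule) (fun s => fst (p s) ^ 2) (fun s => snd (p s) ^ 2));
    now apply is_derive_pow. }
  pose proof (is_derive_div _ _ _ _ _ h1 hd hn) as d1.
  pose proof (is_derive_div _ _ _ _ _ (is_derive_opp (V := R_NormedModule) _ _ _ h2) hd hn) as d2.
  pose proof (is_derive_Cpair _ _ _ _ _ d1 d2) as d.
  match type of d with is_derive _ _ ?u => replace (- l / (p x * p x))%C with u; [exact d|] end.
  apply injective_projections; unfold n, opp; simpl.
  - field. split; [|intros h; apply hn; simpl; lra].
    intros h. apply hn. simpl.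
    assert (h0 : (fst (p x) * (fst (p x) * 1) + snd (p x) * (snd (p x) * 1)) ^ 2 = 0) by (rewrite <- h; ring).
    nra.
  - field. split; [|intros h; apply hn; simpl; lra].
    intros h. apply hn. simpl.
    assert (h0 : (fst (p x) * (fst (p x) * 1) + snd (p x) * (snd (p x) * 1)) ^ 2 = 0) by (rewrite <- h; ring).
    nra.
Qed.

(** Chain rule in the plane.  Existence of the two partial derivatives with one of
    them continuous suffices for differentiability at the point. *)
Lemma is_derive_along_curve (F Fx : R -> R -> R) (Ft : R) (p1 p2 : R -> R) (z dX dT : R) :
  locally (p1 z, p2 z) (fun p => is_derive (fun s => F s (snd p)) (fst p) (Fx (fst p) (snd p))) ->
  is_derive (fun t => F (p1 z) t) (p2 z) Ft ->
  continuous (fun p => Fx (fst p) (snd p)) (p1 z, p2 z) ->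
  is_derive p1 z dX -> is_derive p2 z dT ->
  is_derive (fun s => F (p1 s) (p2 s)) z (dX * Fx (p1 z) (p2 z) + dT * Ft).
Proof.
  intros hx ht hc hX hT.
  pose proof (is_derive_filterdiff F (p1 z) (p2 z) Fx Ft hx ht hc) as hF.
  apply (filterdiff_ext_lin (U := R_NormedModule) (V := R_NormedModule) (fun s => F (p1 s) (p2 s))
    (fun h : R => plus (scal (scal h dX) (Fx (p1 z) (p2 z))) (scal (scal h dT) Ft))).
  - apply (filterdiff_comp'_2 p1 p2 F z (fun h : R => scal h dX) (fun h : R => scal h dT)
      (fun a b : R => plus (scal a (Fx (p1 z) (p2 z))) (scal b Ft)) hX hT hF).
  - intros h. unfold plus, scal; simpl. unfold mult; simpl. ring.
Qed.

Lemma is_derive_along_curve_C (F Fx : R * R -> C) (Ft : C) (p1 p2 : R -> R) (z dX dT : R) :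
  locally (p1 z, p2 z) (fun p =>
    is_derive (V := C_R_NormedModule) (fun s => F (s, snd p)) (fst p) (Fx p)) ->
  is_derive (V := C_R_NormedModule) (fun t => F (p1 z, t)) (p2 z) Ft ->
  continuous Fx (p1 z, p2 z) ->
  is_derive p1 z dX -> is_derive p2 z dT ->
  is_derive (V := C_R_NormedModule) (fun s => F (p1 s, p2 s)) z
    (RtoC dX * Fx (p1 z, p2 z) + RtoC dT * Ft)%C.
Proof.
  intros hx ht hc hX hT.
  apply (is_derive_ext (V := C_R_NormedModule) (fun s => (fst (F (p1 s, p2 s)), snd (F (p1 s, p2 s))))).
  { intros s. now destruct (F (p1 s, p2 s)). }
  replace (RtoC dX * Fx (p1 z, p2 z) + RtoC dT * Ft)%C with
    ((dX * fst (Fx (p1 z, p2 z)) + dT * fst Ft, dX * snd (Fx (p1 z, p2 z)) + dT * snd Ft) : C).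
  2:{ apply injective_projections; simpl; ring. }
  apply (is_derive_pair (U := R_NormedModule) (V := R_NormedModule)).
  - apply (is_derive_along_curve (fun x t => fst (F (x, t))) (fun x t => fst (Fx (x, t)))); trivial.
    + revert hx. apply filter_imp. intros [x t] h.
      apply (is_derive_fst (U := R_NormedModule) (V := R_NormedModule) (fun s => F (s, t)) x _ h).
    + apply (is_derive_fst (U := R_NormedModule) (V := R_NormedModule) (fun s => F (p1 z, s)) _ _ ht).
    + apply (continuous_ext (fun p => fst (Fx p))); [now intros [? ?]|]. now apply continuous_Re.
  - apply (is_derive_along_curve (fun x t => snd (F (x, t))) (fun x t => snd (Fx (x, t)))); trivial.
    + revert hx. apply filter_imp. intros [x t] h.
      apply (is_derive_snd (U := R_NormedModule) (V := R_NormedModule) (fun s => F (s, t)) x _ h).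
    + apply (is_derive_snd (U := R_NormedModule) (V := R_NormedModule) (fun s => F (p1 z, s)) _ _ ht).
    + apply (continuous_ext (fun p => snd (Fx p))); [now intros [? ?]|]. now apply continuous_Im.
Qed.

Lemma is_derive_within_continuous_on D (f f' : R -> C) :
  (forall x, D x -> is_derive_within D f x (f' x)) -> continuous_on D f.
Proof.
  intros hd x hx.
  apply (filterdiff_continuous_aux (U := R_NormedModule) (V := C_R_NormedModule) (F := within D (locally x))).
  - eexists. now apply hd.
  - intros P hP. unfold within. generalize hP. now apply filter_imp.
Qed.

Lemma is_derive_within_interior D (f : R -> C) (x : R) (l : C) :
  is_derive_within D f x l -> locally x D -> is_derive (V := C_R_NormedModule) f x l.
Proof.
  intros [hl hd] hD. split; [apply hl|]. intros y hy eps.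
  assert (hy' : is_filter_lim (within D (locally x)) y).
  { intros P hP. unfold within. generalize (hy P hP). now apply filter_imp. }
  specialize (hd y hy' eps). unfold within in hd.
  generalize (filter_and _ _ hD hd). apply filter_imp. intros u [hu hu']. now apply hu'.
Qed.

(** * Integrals of complex-valued functions *)

(** The integral with its value typed as a complex number, so that [ring] and
    [field] apply to expressions containing it. *)
Definition CInt (h : R -> C) (a b : R) : C := RInt (V := C_R_CompleteNormedModule) h a b.

Lemma CInt_correct (h : R -> C) (a b : R) :
  (forall s, continuous h s) -> is_RInt (V := C_R_NormedModule) h a b (CInt h a b).
Proof.
  intros hh. apply (RInt_correct (V := C_R_CompleteNormedModule)). apply ex_RInt_continuous. intros; apply hh.
Qed.

Lemma CInt_unique (h : R -> C) (a b : R) (l : C) :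
  is_RInt (V := C_R_NormedModule) h a b l -> CInt h a b = l.
Proof. apply (is_RInt_unique (V := C_R_CompleteNormedModule)). Qed.

Lemma CInt_point (h : R -> C) (a : R) : CInt h a a = RtoC 0.
Proof. apply CInt_unique, (is_RInt_point (V := C_R_NormedModule)). Qed.

Lemma CInt_swap (h : R -> C) (a b : R) :
  (forall s, continuous h s) -> CInt h a b = (- CInt h b a)%C.
Proof.
  intros hh. apply CInt_unique.
  apply (is_RInt_swap (V := C_R_NormedModule) h). now apply CInt_correct.
Qed.

Lemma CInt_Chasles (h : R -> C) (a b c : R) :
  (forall s, continuous h s) -> (CInt h a b + CInt h b c)%C = CInt h a c.
Proof.
  intros hh. symmetry. apply CInt_unique.
  apply (is_RInt_Chasles (V := C_R_NormedModule) h a b c); now apply CInt_correct.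
Qed.

Lemma CInt_minus (h1 h2 : R -> C) (a b : R) :
  (forall s, continuous h1 s) -> (forall s, continuous h2 s) ->
  CInt (fun s => h1 s - h2 s)%C a b = (CInt h1 a b - CInt h2 a b)%C.
Proof.
  intros hh1 hh2. apply CInt_unique.
  apply (is_RInt_minus (V := C_R_NormedModule) h1 h2); now apply CInt_correct.
Qed.

Lemma CInt_ext (h1 h2 : R -> C) (a b : R) :
  (forall s, Rmin a b < s < Rmax a b -> h1 s = h2 s) -> CInt h1 a b = CInt h2 a b.
Proof. apply (RInt_ext (V := C_R_CompleteNormedModule)). Qed.

Lemma is_derive_CInt (h : R -> C) (a x : R) :
  (forall s, continuous h s) -> is_derive (V := C_R_NormedModule) (CInt h a) x (h x).
Proof.
  intros hh. apply (is_derive_RInt (V := C_R_NormedModule) h _ a); [|apply hh].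
  apply filter_forall. intros u. now apply CInt_correct.
Qed.

(** The derivative is only assumed at interior points, because solutions of the
    Vekua equation are differentiable in the open square only.  The difference
    of the two sides has derivative zero there and is continuous up to the
    endpoints, so the mean value theorem makes it constant. *)
Lemma CInt_derive (F g : R -> C) (a b : R) :
  (forall s, continuous F s) -> (forall s, continuous g s) ->
  (forall s, Rmin a b < s < Rmax a b -> is_derive (V := C_R_NormedModule) F s (g s)) ->
  CInt g a b = (F b - F a)%C.
Proof.
  intros hF hg hd.
  set (Phi := fun s => (F s - CInt g a s)%C).
  assert (hI : forall s, is_derive (V := C_R_NormedModule) (CInt g a) s (g s)).
  { intros s. now apply is_derive_CInt. }
  assert (hPhi : forall s, continuous Phi s).
  { intros s. apply continuous_Cminus; [apply hF|].
    apply (ex_derive_continuous (V := C_R_NormedModule)). eexists; apply hI. }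
  assert (hPhi' : forall s, Rmin a b < s < Rmax a b ->
    is_derive (V := C_R_NormedModule) Phi s (RtoC 0)).
  { intros s hs. replace (RtoC 0) with (g s - g s)%C by ring.
    apply (is_derive_minus (V := C_R_NormedModule) F (CInt g a)); [now apply hd | apply hI]. }
  assert (hc : Phi b = Phi a).
  { apply injective_projections.
    - destruct (MVT_gen (fun s => fst (Phi s)) a b (fun _ => 0)) as (c & _ & h).
      + intros s hs. apply (is_derive_fst (U := R_NormedModule) (V := R_NormedModule) Phi s (0, 0)).
        now apply hPhi'.
      + intros s _. apply continuity_pt_filterlim. apply (continuous_Re Phi s), hPhi.
      + lra.
    - destruct (MVT_gen (fun s => snd (Phi s)) a b (fun _ => 0)) as (c & _ & h).
      + intros s hs. apply (is_derive_snd (U := R_NormedModule) (V := R_NormedModule) Phi s (0, 0)).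
        now apply hPhi'.
      + intros s _. apply continuity_pt_filterlim. apply (continuous_Im Phi s), hPhi.
      + lra. }
  unfold Phi in hc. rewrite CInt_point in hc.
  replace (F b) with ((F b - CInt g a b) + CInt g a b)%C by ring.
  rewrite hc. ring.
Qed.

Lemma Cmod_CInt_le_const (h : R -> C) (a z M : R) :
  (forall s, continuous h s) ->
  (forall s, Rmin a z <= s <= Rmax a z -> Cmod (h s) <= M) ->
  Cmod (CInt h a z) <= M * Rabs (z - a).
Proof.
  intros hc hb.
  destruct (Rle_or_lt a z) as [haz | hza].
  - rewrite Rmin_left, Rmax_right in hb by lra.
    rewrite Rabs_pos_eq, Rmult_comm, <- norm_Cmod by lra.
    apply (norm_RInt_le_const (V := C_R_NormedModule) h a z); [lra | |].
    + intros s hs. rewrite norm_Cmod. now apply hb.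
    + now apply CInt_correct.
  - rewrite Rmin_right, Rmax_left in hb by lra.
    rewrite CInt_swap, Cmod_opp by trivial.
    rewrite Rabs_left1, Rmult_comm, <- norm_Cmod by lra.
    replace (- (z - a)) with (a - z) by ring.
    apply (norm_RInt_le_const (V := C_R_NormedModule) h z a); [lra | |].
    + intros s hs. rewrite norm_Cmod. now apply hb.
    + now apply CInt_correct.
Qed.

(** Integration from the base point a gains a factor 1 / L on exponentials of
    rate L centred at a; this gain makes the Volterra operators contractions. *)
Lemma Cmod_CInt_le_exp (h : R -> C) (a z L M : R) :
  0 < L -> 0 <= M -> (forall s, continuous h s) ->
  (forall s, Rmin a z <= s <= Rmax a z -> Cmod (h s) <= M * exp (L * Rabs (s - a))) ->
  Cmod (CInt h a z) <= M / L * exp (L * Rabs (z - a)).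
Proof.
  intros hL hM hc hb.
  assert (hprim : forall u v k : R, k <> 0 ->
    is_RInt (fun s => M * exp (k * (s - a))) u v
      (M / k * exp (k * (v - a)) - M / k * exp (k * (u - a)))).
  { intros u v k hk.
    apply (is_RInt_derive (fun s => M / k * exp (k * (s - a)))).
    - intros s _. auto_derive; [easy|]. unfold Rminus. field. exact hk.
    - intros s _. apply (ex_derive_continuous (fun s => M * exp (k * (s - a)))).
      auto_derive. easy. }
  assert (hML : 0 <= M / L) by (apply Rdiv_le_0_compat; lra).
  destruct (Rle_or_lt a z) as [haz | hza].
  - rewrite Rmin_left, Rmax_right in hb by lra.
    assert (hb' : forall s, a <= s <= z ->
      norm (V := C_R_NormedModule) (h s) <= M * exp (L * (s - a))).
    { intros s hs. rewrite norm_Cmod. specialize (hb s hs).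
      rewrite Rabs_pos_eq in hb by lra. exact hb. }
    pose proof (norm_RInt_le (V := C_R_NormedModule) h _ a z _ _ haz hb'
      (CInt_correct h a z hc) (hprim a z L ltac:(lra))) as H.
    rewrite norm_Cmod in H. rewrite Rabs_pos_eq by lra.
    pose proof (Rmult_le_pos _ _ hML (Rlt_le _ _ (exp_pos (L * (a - a))))). lra.
  - rewrite Rmin_right, Rmax_left in hb by lra.
    rewrite CInt_swap, Cmod_opp, <- norm_Cmod by trivial.
    assert (hb' : forall s, z <= s <= a ->
      norm (V := C_R_NormedModule) (h s) <= M * exp (- L * (s - a))).
    { intros s hs. rewrite norm_Cmod. eapply Rle_trans; [apply hb, hs|].
      rewrite Rabs_left1 by lra. right. f_equal. f_equal. ring. }
    pose proof (norm_RInt_le (V := C_R_NormedModule) h _ z a _ _ (Rlt_le _ _ hza) hb'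
      (CInt_correct h z a hc) (hprim z a (- L) ltac:(lra))) as H.
    eapply Rle_trans; [apply H|]. rewrite (Rabs_left1 (z - a)) by lra.
    replace (- L * (z - a)) with (L * - (z - a)) by ring.
    replace (M / - L) with (- (M / L)) by (field; lra).
    pose proof (Rmult_le_pos _ _ hML (Rlt_le _ _ (exp_pos (- L * (a - a))))). lra.
Qed.

(** * Jointly continuous functions of two real variables *)

Definition jointly_continuous (h : R -> R -> C) : Prop :=
  forall p : R * R, continuous (fun q : R * R => h (fst q) (snd q)) p.

Lemma jointly_continuous_eps (h : R -> R -> C) (s0 y0 : R) (eps : posreal) :
  jointly_continuous h ->
  exists d : posreal, forall s y, Rabs (s - s0) < d -> Rabs (y - y0) < d ->
    Cmod (h s y - h s0 y0)%C < eps.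
Proof.
  intros hh.
  destruct (proj1 (continuous_C_iff _ _) (hh (s0, y0)) eps) as [d hd].
  exists d. intros s y hs hy. apply (hd (s, y)). split; [apply hs | apply hy].
Qed.

(** Continuity in the second variable is uniform over a compact range of the first:
    a Lebesgue number of the cover of the segment by neighbourhoods on which h
    oscillates by less than eps / 2. *)
Lemma tube_lemma (h : R -> R -> C) (a b y0 : R) (eps : posreal) :
  jointly_continuous h ->
  exists d : posreal, forall s y, a <= s <= b -> Rabs (y - y0) < d ->
    Cmod (h s y - h s y0)%C < eps.
Proof.
  intros hh.
  destruct (functional_choice _ (fun s => jointly_continuous_eps h s y0 (pos_div_2 eps) hh)) as [delta hdelta].
  destruct (compactness_value_1d a b delta) as [d hd].
  exists d. intros s y hs hy.
  destruct (NNPP _ (hd s hs)) as (t & ht & hst & hdt).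
  pose proof (hdelta t s y hst (Rlt_le_trans _ _ _ hy hdt)) as h1.
  pose proof (hdelta t s y0 hst) as h2.
  rewrite Rminus_diag, Rabs_R0 in h2. specialize (h2 (cond_pos _)).
  replace (h s y - h s y0)%C with ((h s y - h t y0) + - (h s y0 - h t y0))%C by ring.
  eapply Rle_lt_trans. apply Cmod_triangle. rewrite Cmod_opp.
  simpl in h1, h2. lra.
Qed.

(** The radius attached to a point is chosen so small that its inverse bounds
    |h| at that point; a Lebesgue number d of the resulting cover then bounds
    |h| on the whole box by 1 + 1 / d. *)
Lemma bounded_on_box (h : R -> R -> C) (c : R) :
  jointly_continuous h ->
  exists M, 0 <= M /\ forall y z, - c <= y <= c -> - c <= z <= c -> Cmod (h y z) <= M.
Proof.
  intros hh.
  assert (loc : forall p : R * R, exists d : posreal,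
    Cmod (h (fst p) (snd p)) <= / d /\
    forall s y, Rabs (s - fst p) < d -> Rabs (y - snd p) < d ->
      Cmod (h s y - h (fst p) (snd p))%C < 1).
  { intros [s0 y0]; simpl.
    destruct (jointly_continuous_eps h s0 y0 (mkposreal 1 Rlt_0_1) hh) as [d hd].
    pose proof (Cmod_ge_0 (h s0 y0)) as hc.
    assert (hd' : 0 < Rmin d (/ (1 + Cmod (h s0 y0)))).
    { apply Rmin_pos. apply cond_pos. apply Rinv_0_lt_compat. lra. }
    exists (mkposreal _ hd'). simpl. split.
    - apply Rle_trans with (/ / (1 + Cmod (h s0 y0))).
      + rewrite Rinv_inv. lra.
      + apply Rinv_le_contravar. exact hd'. apply Rmin_r.
    - intros s y hs hy. apply hd; eapply Rlt_le_trans; try apply hs; try apply hy; apply Rmin_l. }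
  destruct (functional_choice _ loc) as [delta hdelta].
  destruct (compactness_value_2d (- c) c (- c) c (fun u v => delta (u, v))) as [d hd].
  pose proof (Rinv_0_lt_compat d (cond_pos d)).
  exists (1 + / d). split; [lra|].
  intros y z hy hz.
  destruct (NNPP _ (hd y z hy hz)) as (u & v & _ & _ & hyu & hzv & hdt).
  destruct (hdelta (u, v)) as [h1 h2]. specialize (h2 y z hyu hzv). simpl in h1, h2.
  replace (h y z) with ((h y z - h u v) + h u v)%C by ring.
  eapply Rle_trans. apply Cmod_triangle.
  pose proof (Rinv_le_contravar _ _ (cond_pos d) hdt). lra.
Qed.

Lemma family_bounded_on_box (V : bool -> R -> R -> C) (c : R) :
  (forall i, jointly_continuous (V i)) ->
  exists M, 0 <= M /\ forall i y z, Rabs y <= c -> Rabs z <= c -> Cmod (V i y z) <= M.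
Proof.
  intros hV.
  destruct (bounded_on_box (V true) c (hV true)) as (M1 & h1 & hb1).
  destruct (bounded_on_box (V false) c (hV false)) as (M2 & h2 & hb2).
  exists (M1 + M2). split; [lra|]. intros i y z hy hz.
  apply Rabs_le_between in hy, hz.
  destruct i; [specialize (hb1 y z hy hz) | specialize (hb2 y z hy hz)]; lra.
Qed.

Lemma jointly_continuous_section (h : R -> R -> C) (y s : R) :
  jointly_continuous h -> continuous (fun s => h s y) s.
Proof.
  intros hh. apply (continuous_comp_2 (fun s => s) (fun _ => y) h).
  apply continuous_id. apply continuous_const. apply hh.
Qed.

(** The increment is split into the change of the upper limit, for the integrand
    frozen at y0, and the change of the integrand, controlled by [tube_lemma]. *)
Lemma jointly_continuous_CInt (h : R -> R -> C) :
  jointly_continuous h ->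
  jointly_continuous (fun y z => CInt (fun s => h s y) 0 z).
Proof.
  intros hh [y0 z0].
  assert (hsec : forall y s, continuous (fun s => h s y) s).
  { intros. now apply jointly_continuous_section. }
  apply (continuous_ext (fun q : R * R =>
    CInt (fun s => h s y0) 0 (snd q) +
    CInt (fun s => h s (fst q) - h s y0)%C 0 (snd q))%C).
  { intros [y z]. simpl.
    rewrite CInt_minus by trivial.
    match goal with |- @eq _ ?a ?b => change (@eq C a b) end. ring. }
  apply continuous_Cplus.
  - apply (continuous_comp snd (fun z => CInt (fun s => h s y0) 0 z)).
    apply continuous_snd. simpl.
    apply (ex_derive_continuous (V := C_R_NormedModule)).
    exists (h z0 y0). apply (is_derive_RInt (V := C_R_NormedModule) (fun s => h s y0) _ 0).
    + apply filter_forall. intros z. now apply CInt_correct.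
    + apply hsec.
  - apply continuous_C_iff. intros eps.
    set (r := Rabs z0 + 1).
    assert (hr : 0 < r) by (pose proof (Rabs_pos z0); unfold r; lra).
    destruct (tube_lemma h (- r) r y0 (mkposreal _ (Rdiv_lt_0_compat _ _ (cond_pos eps) hr)) hh)
      as [d hd].
    simpl in hd.
    assert (hd1 : 0 < Rmin d 1) by (apply Rmin_pos; [apply cond_pos | lra]).
    exists (mkposreal _ hd1). intros [y z] [hy hz].
    change (Rabs (y - y0) < Rmin d 1) in hy. change (Rabs (z - z0) < Rmin d 1) in hz.
    pose proof (Rmin_l d 1). pose proof (Rmin_r d 1). simpl.
    replace (CInt (fun s => h s y0 - h s y0)%C 0 z0) with (RtoC 0).
    2:{ rewrite CInt_minus by trivial. ring. }
    replace (CInt (fun s => h s y - h s y0)%C 0 z - 0)%C with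
       (CInt (fun s => h s y - h s y0)%C 0 z) by ring.
    assert (hzr : Rabs z < r).
    { unfold r. replace z with ((z - z0) + z0) by ring.
      eapply Rle_lt_trans. apply Rabs_triang. lra. }
    apply Rle_lt_trans with (eps / r * Rabs (z - 0)).
    + apply Cmod_CInt_le_const.
      * intros s. now apply continuous_Cminus.
      * intros s hs. left. apply hd; [|lra].
        apply Rabs_def2 in hzr. unfold Rmin, Rmax in hs; destruct (Rle_dec 0 z); lra.
    + rewrite Rminus_0_r. apply Rlt_le_trans with (eps / r * r).
      apply Rmult_lt_compat_l; trivial. apply Rdiv_lt_0_compat; [apply cond_pos | trivial].
      right. field. lra.
Qed.

(** * Volterra equations along characteristics *)

(** The integral operator of the system d/dz V_i(y, z) = G(y + z) V_(not i)(z, y).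
    The coordinates are exchanged under the integral because the family of
    characteristics along which V_i is transported is the transverse one for
    V_(not i). *)
Definition volterra (G : R -> C) (V : bool -> R -> R -> C) (a : R) (i : bool) (y z : R) : C :=
  CInt (fun s => G (y + s)%R * V (negb i) s y)%C a z.

Lemma continuous_volterra_integrand (G : R -> C) (h : R -> R -> C) (y s : R) :
  (forall r, continuous G r) -> jointly_continuous h ->
  continuous (fun s => G (y + s)%R * h s y)%C s.
Proof.
  intros hG hh. apply continuous_Cmult.
  - apply (continuous_comp (fun s => y + s) G); [|apply hG].
    apply (continuous_plus (V := R_NormedModule)); [apply continuous_const | apply continuous_id].
  - apply (continuous_comp_2 (fun s => s) (fun _ => y) h).
    apply continuous_id. apply continuous_const. apply hh.
Qed.

Lemma jointly_continuous_integrand (G : R -> C) (h : R -> R -> C) :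
  (forall r, continuous G r) -> jointly_continuous h ->
  jointly_continuous (fun s y => G (y + s)%R * h s y)%C.
Proof.
  intros hG hh p. apply continuous_Cmult; [|apply hh].
  apply (continuous_comp (fun q : R * R => snd q + fst q) G); [|apply hG].
  destruct p. apply (continuous_plus (V := R_NormedModule) snd fst).
  apply continuous_snd. apply continuous_fst.
Qed.

Lemma volterra_minus G V1 V2 a i y z :
  (forall r, continuous G r) -> (forall i, jointly_continuous (V1 i)) ->
  (forall i, jointly_continuous (V2 i)) ->
  volterra G (fun i y z => V1 i y z - V2 i y z)%C a i y z
  = (volterra G V1 a i y z - volterra G V2 a i y z)%C.
Proof.
  intros hG h1 h2. unfold volterra.
  rewrite <- CInt_minus by (intros; now apply continuous_volterra_integrand).
  apply CInt_ext. intros s _. ring.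
Qed.

(** The data are given on the curve z = a(y) and w is the distance to it along
    characteristics, up to a term m(y) that is constant on each of them.  The
    symmetry of w makes one weight serve both components of the system, and
    the last condition says that the region contains its domains of dependence. *)
Definition characteristic_region (a m : R -> R) (w : R -> R -> R) (Om : R -> R -> Prop) : Prop :=
  (forall y z, w y z = Rabs (z - a y) + m y) /\
  (forall y z, w y z = w z y) /\
  (forall y z s, Om y z -> Rmin (a y) z <= s <= Rmax (a y) z -> Om s y).

(** Data on z = 0: for V_i this is one diagonal of the (x, t) plane, and the region
    is the square |x|, |t| <= c / 2. *)
Lemma goursat_region (c : R) :
  characteristic_region (fun _ => 0) Rabs (fun y z => Rabs y + Rabs z)
    (fun y z => Rabs y + Rabs z <= c).
Proof.
  repeat split; intros.
  - rewrite Rminus_0_r. ring.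
  - ring.
  - apply Rle_trans with (2 := H). rewrite Rplus_comm. apply Rplus_le_compat_l.
    unfold Rmin, Rmax in H0. destruct (Rle_dec 0 z); unfold Rabs; destruct (Rcase_abs s), (Rcase_abs z); lra.
Qed.

Lemma goursat_box (c : R) :
  characteristic_region (fun _ => 0) Rabs (fun y z => Rabs y + Rabs z)
    (fun y z => Rabs y <= c /\ Rabs z <= c).
Proof.
  repeat split; intros.
  - rewrite Rminus_0_r. ring.
  - ring.
  - apply Rle_trans with (2 := proj2 H).
    unfold Rmin, Rmax in H0. destruct (Rle_dec 0 z); unfold Rabs; destruct (Rcase_abs s), (Rcase_abs z); lra.
  - apply H.
Qed.

(** Data on z = - y, the line x = 0.  The region is the hexagon cut out of the
    diamond |x| + |t| <= c by the strip |x| <= c / 2, so it contains the square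
    |x|, |t| <= c / 2. *)
Lemma cauchy_region (c : R) :
  characteristic_region Ropp (fun _ => 0) (fun y z => Rabs (y + z))
    (fun y z => Rabs y <= c /\ Rabs z <= c /\ Rabs (y + z) <= c).
Proof.
  repeat split; intros.
  - rewrite Rplus_0_r. f_equal. ring.
  - f_equal. ring.
  - destruct H as (h1 & h2 & h3). apply Rabs_le_between in h1, h2, h3. apply Rabs_le_between.
    unfold Rmin, Rmax in H0. destruct (Rle_dec (- y) z); lra.
  - apply H.
  - destruct H as (h1 & h2 & h3). apply Rabs_le_between in h1, h2, h3. apply Rabs_le_between.
    unfold Rmin, Rmax in H0. destruct (Rle_dec (- y) z); lra.
Qed.

Lemma volterra_contraction (G : R -> C) (K : R) a m w Om V M :
  characteristic_region a m w Om -> 0 < K -> 0 <= M ->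
  (forall r, continuous G r) -> (forall r, Cmod (G r) <= K) ->
  (forall i, jointly_continuous (V i)) ->
  (forall i y z, Om y z -> Cmod (V i y z) <= M * exp (2 * K * w y z)) ->
  forall i y z, Om y z ->
    Cmod (volterra G V (a y) i y z) <= M / 2 * exp (2 * K * w y z).
Proof.
  intros (hw & hsym & hpath) hK hM hG hGK hV hb i y z hyz.
  replace (M / 2 * exp (2 * K * w y z)) with
    (M * K * exp (2 * K * m y) / (2 * K) * exp (2 * K * Rabs (z - a y))).
  2:{ rewrite hw, Rmult_plus_distr_l, exp_plus. field. lra. }
  pose proof (exp_pos (2 * K * m y)) as hpos.
  apply Cmod_CInt_le_exp; [lra | apply Rmult_le_pos; [nra | lra] | |].
  { intros s. apply continuous_volterra_integrand; trivial. }
  intros s hs. rewrite Cmod_mult.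
  specialize (hb (negb i) s y (hpath y z s hyz hs)).
  rewrite hsym, hw, Rmult_plus_distr_l, exp_plus in hb.
  pose proof (Cmod_ge_0 (G (y + s))). pose proof (Cmod_ge_0 (V (negb i) s y)).
  specialize (hGK (y + s)).
  eapply Rle_trans. apply Rmult_le_compat; [lra | lra | apply hGK | apply hb].
  right; ring.
Qed.

(** An error d in the integral equation and the contraction of ratio 1/2 bound
    the weighted norm of V by d + M / 2 whenever it is bounded by M.  Iterating
    from the a priori bound leaves only the fixed point 2 d. *)
Lemma volterra_stability (G : R -> C) (K : R) a m w Om V M d :
  characteristic_region a m w Om -> 0 < K -> 0 <= M -> 0 <= d ->
  (forall r, continuous G r) -> (forall r, Cmod (G r) <= K) ->
  (forall i, jointly_continuous (V i)) ->
  (forall y z, Om y z -> 0 <= w y z) ->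
  (forall i y z, Om y z -> Cmod (V i y z) <= M) ->
  (forall i y z, Om y z -> Cmod (V i y z - volterra G V (a y) i y z)%C <= d) ->
  forall i y z, Om y z -> Cmod (V i y z) <= 2 * d * exp (2 * K * w y z).
Proof.
  intros hreg hK hM hd hG hGK hV hw hb hres.
  assert (hexp : forall y z, Om y z -> 1 <= exp (2 * K * w y z)).
  { intros y z hyz. specialize (hw y z hyz).
    pose proof (exp_ineq1_le (2 * K * w y z)). nra. }
  assert (iter : forall n i y z, Om y z ->
    Cmod (V i y z) <= (2 * d + M * (/ 2) ^ n) * exp (2 * K * w y z)).
  { induction n as [|n IH]; intros i y z hyz.
    - specialize (hb i y z hyz). specialize (hexp y z hyz). simpl. nra.
    - assert (hn : 0 <= (/ 2) ^ n) by (apply pow_le; lra).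
      assert (hc := volterra_contraction G K a m w Om V _ hreg hK
         (ltac:(nra) : 0 <= 2 * d + M * (/ 2) ^ n) hG hGK hV IH i y z hyz).
      replace (V i y z) with ((V i y z - volterra G V (a y) i y z) + volterra G V (a y) i y z)%C by ring.
      eapply Rle_trans. apply Cmod_triangle.
      specialize (hres i y z hyz). specialize (hexp y z hyz). simpl. nra. }
  intros i y z hyz.
  apply Rle_trans with (real (Finite (2 * d * exp (2 * K * w y z)))); [|simpl; lra].
  set (e := exp (2 * K * w y z)) in *.
  assert (hlim : is_lim_seq (fun n => (2 * d + M * (/ 2) ^ n) * e) (2 * d * e)).
  { replace (2 * d * e) with ((2 * d + M * 0) * e) by ring.
    apply (is_lim_seq_scal_r _ e (2 * d + M * 0)).
    apply (is_lim_seq_plus' (fun _ => 2 * d) _ (2 * d) (M * 0)). apply is_lim_seq_const.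
    apply (is_lim_seq_scal_l _ M 0). apply is_lim_seq_geom. rewrite Rabs_pos_eq; lra. }
  apply (is_lim_seq_le (fun _ => Cmod (V i y z)) _ (Cmod (V i y z)) (2 * d * e)
    (fun n => iter n i y z hyz) (is_lim_seq_const _) hlim).
Qed.

(** * Approximate continuation and stability of the Cauchy problem *)

(** Partial sums of the Neumann series of the Goursat problem with data D. *)
Fixpoint neumann (G : R -> C) (D : bool -> R -> C) (n : nat) : bool -> R -> R -> C :=
  match n with
  | O => fun i y _ => D i y
  | S m => fun i y z => (D i y + volterra G (neumann G D m) 0 i y z)%C
  end.

Lemma jointly_continuous_neumann G D n i :
  (forall r, continuous G r) -> (forall i y, continuous (D i) y) ->
  jointly_continuous (neumann G D n i).
Proof.
  intros hG hD.
  assert (hD' : forall i, jointly_continuous (fun y _ => D i y)).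
  { intros j [y z]. apply (continuous_comp fst (D j)). apply continuous_fst. apply hD. }
  revert i. induction n as [|n IH]; intros i; simpl.
  - apply hD'.
  - intros p. apply continuous_Cplus. apply (hD' i).
    apply (jointly_continuous_CInt (fun s y => G (y + s)%R * neumann G D n (negb i) s y)%C).
    apply jointly_continuous_integrand; trivial.
Qed.

(** The increment of the partial sums is minus the residual of [neumann G D n] in
    the Goursat problem, and each step is one application of the contraction. *)
Lemma neumann_increment G K D c M n i y z :
  0 < K -> 0 <= M ->
  (forall r, continuous G r) -> (forall r, Cmod (G r) <= K) ->
  (forall i y, continuous (D i) y) ->
  (forall i y, Rabs y <= c -> Cmod (D i y) <= M) ->
  Rabs y <= c -> Rabs z <= c ->
  Cmod (neumann G D (S n) i y z - neumann G D n i y z)%C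
    <= M * (/ 2) ^ n * exp (2 * K * (Rabs y + Rabs z)).
Proof.
  intros hK hM hG hGK hD hb.
  pose proof (jointly_continuous_neumann G D) as hcont.
  revert i y z. induction n as [|n IH]; intros i y z hy hz.
  - simpl. replace (D i y + volterra G (fun i y _ => D i y) 0 i y z - D i y)%C
      with (volterra G (fun i y _ => D i y) 0 i y z) by ring.
    eapply Rle_trans.
    + apply (volterra_contraction G K (fun _ => 0) _ _ _ (fun i y _ => D i y) M (goursat_box c));
        trivial; [intros j; apply (hcont 0%nat); trivial| |now split].
      intros j u v [hu hv]. specialize (hb j u hu). pose proof (Rabs_pos u). pose proof (Rabs_pos v).
      pose proof (exp_ineq1_le (2 * K * (Rabs u + Rabs v))).
      assert (0 <= 2 * K * (Rabs u + Rabs v)) by (apply Rmult_le_pos; lra). nra.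
    + apply Rmult_le_compat_r. left; apply exp_pos. lra.
  - change (neumann G D (S (S n)) i y z) with (D i y + volterra G (neumann G D (S n)) 0 i y z)%C.
    change (neumann G D (S n) i y z) with (D i y + volterra G (neumann G D n) 0 i y z)%C.
    replace (D i y + volterra G (neumann G D (S n)) 0 i y z - (D i y + volterra G (neumann G D n) 0 i y z))%C
      with (volterra G (neumann G D (S n)) 0 i y z - volterra G (neumann G D n) 0 i y z)%C by ring.
    rewrite <- volterra_minus by (trivial; intros; now apply hcont).
    replace (M * (/ 2) ^ S n) with (M * (/ 2) ^ n / 2) by (simpl; field).
    apply (volterra_contraction G K (fun _ => 0) _ _ _ _ (M * (/ 2) ^ n) (goursat_box c)); trivial.
    + apply Rmult_le_pos; trivial. apply pow_le. lra.
    + intros j p. apply continuous_Cminus; apply hcont; trivial.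
    + intros j u v [hu hv]. now apply IH.
    + now split.
Qed.

Lemma Cmod_minus_sym (u v : C) : Cmod (u - v)%C = Cmod (v - u)%C.
Proof. rewrite <- Cmod_opp. f_equal. ring. Qed.

Lemma geometric_small (M e : R) : 0 <= M -> 0 < e -> exists n, M * (/ 2) ^ n <= e.
Proof.
  intros hM he.
  destruct (pow_lt_1_zero (/ 2) ltac:(rewrite Rabs_pos_eq; lra) (e / (M + 1))) as [n hn].
  { apply Rdiv_lt_0_compat; lra. }
  exists n. specialize (hn n (le_n n)).
  assert (hp : 0 <= (/ 2) ^ n) by (apply pow_le; lra).
  rewrite Rabs_pos_eq in hn by trivial.
  apply (Rmult_lt_compat_l (M + 1)) in hn; [|lra].
  replace ((M + 1) * (e / (M + 1))) with e in hn by (field; lra). nra.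
Qed.

(** A solution known on the square only is continued, approximately, to the whole
    box.  The Neumann sums built from its Goursat data have a small residual on
    the box, and on the square stability keeps them close to V. *)
Lemma approximate_goursat_extension (G : R -> C) (K c : R) (V : bool -> R -> R -> C) (d : R) :
  0 < K -> 0 <= c ->
  (forall r, continuous G r) -> (forall r, Cmod (G r) <= K) ->
  (forall i, jointly_continuous (V i)) ->
  (forall i y z, Rabs y + Rabs z <= c -> V i y z = (V i y 0 + volterra G V 0 i y z)%C) ->
  0 < d ->
  exists S : bool -> R -> R -> C,
    (forall i, jointly_continuous (S i)) /\
    (forall i y z, Rabs y <= c -> Rabs z <= c ->
      Cmod (S i y z - S i y 0 - volterra G S 0 i y z)%C <= d) /\
    (forall i y z, Rabs y + Rabs z <= c -> Cmod (V i y z - S i y z)%C <= d).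
Proof.
  intros hK hc hG hGK hV hmild hd.
  set (D := fun i y => V i y 0).
  assert (hD : forall i y, continuous (D i) y).
  { intros i y. apply (continuous_comp_2 (fun y => y) (fun _ => 0) (V i)).
    apply continuous_id. apply continuous_const. apply hV. }
  destruct (family_bounded_on_box V c hV) as (M & hM & hVM).
  assert (hDM : forall i y, Rabs y <= c -> Cmod (D i y) <= M).
  { intros i y hy. apply hVM; trivial. now rewrite Rabs_R0. }
  set (Lam := exp (2 * K * (2 * c))).
  assert (hLam : 1 <= Lam).
  { pose proof (exp_ineq1_le (2 * K * (2 * c))). assert (0 <= 2 * K * (2 * c)) by nra. unfold Lam; lra. }
  (* The residual must be below d / (2 Lam): stability costs a factor 2 Lam. *)
  destruct (geometric_small (M * Lam) (d / (2 * Lam))) as [n hn].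
  { nra. } { apply Rdiv_lt_0_compat; lra. }
  assert (hcont : forall i, jointly_continuous (neumann G D n i)).
  { intros i. now apply jointly_continuous_neumann. }
  assert (hexp : forall y z, Rabs y <= c -> Rabs z <= c ->
     exp (2 * K * (Rabs y + Rabs z)) <= Lam).
  { intros y z hy hz.
    destruct (Rle_lt_or_eq_dec (2 * K * (Rabs y + Rabs z)) (2 * K * (2 * c))) as [h|h].
    - apply Rmult_le_compat_l; lra.
    - left. now apply exp_increasing.
    - right. unfold Lam. now rewrite h. }
  assert (hdL : d / (2 * Lam) <= d / 2).
  { apply Rmult_le_compat_l; [lra|]. apply Rinv_le_contravar; lra. }
  assert (h0 : forall i y, neumann G D n i y 0 = D i y).
  { intros i y. destruct n; simpl; trivial. unfold volterra. rewrite CInt_point. ring. }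
  assert (hres : forall i y z, Rabs y <= c -> Rabs z <= c ->
     Cmod (neumann G D n i y z - D i y - volterra G (neumann G D n) 0 i y z)%C <= d / (2 * Lam)).
  { intros i y z hy hz.
    replace (neumann G D n i y z - D i y - volterra G (neumann G D n) 0 i y z)%C
      with (neumann G D n i y z - neumann G D (S n) i y z)%C by (simpl; ring).
    rewrite Cmod_minus_sym.
    eapply Rle_trans. apply (neumann_increment G K D c M n i y z); trivial.
    eapply Rle_trans. 2: apply hn.
    replace (M * Lam * (/ 2) ^ n) with (M * (/ 2) ^ n * Lam) by ring.
    apply Rmult_le_compat_l; [|now apply hexp].
    apply Rmult_le_pos; trivial. apply pow_le. lra. }
  exists (neumann G D n). repeat split; trivial.
  - intros i y z hy hz. rewrite h0. specialize (hres i y z hy hz). lra.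
  - assert (hE : forall i, jointly_continuous (fun y z => V i y z - neumann G D n i y z)%C).
    { intros i p. apply continuous_Cminus; [apply hV | apply hcont]. }
    destruct (family_bounded_on_box _ c hE) as (M' & hM' & hb).
    intros i y z hyz.
    pose proof (Rabs_pos y). pose proof (Rabs_pos z).
    assert (hdpos : 0 < d / (2 * Lam)) by (apply Rdiv_lt_0_compat; lra).
    eapply Rle_trans.
    + apply (volterra_stability G K (fun _ => 0) Rabs (fun y z => Rabs y + Rabs z)
        (fun y z => Rabs y + Rabs z <= c)
        (fun i y z => V i y z - neumann G D n i y z)%C M' (d / (2 * Lam)) (goursat_region c)); trivial; try lra.
      * intros u v _. pose proof (Rabs_pos u). pose proof (Rabs_pos v). lra.
      * intros j u v huv. pose proof (Rabs_pos u). pose proof (Rabs_pos v). apply hb; lra.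
      * intros j u v huv. rewrite volterra_minus by trivial.
        rewrite (hmild j u v huv). fold (D j u).
        pose proof (Rabs_pos u). pose proof (Rabs_pos v).
        rewrite <- Cmod_opp.
        replace (- (D j u + volterra G V 0 j u v - neumann G D n j u v -
          (volterra G V 0 j u v - volterra G (neumann G D n) 0 j u v)))%C
         with (neumann G D n j u v - D j u - volterra G (neumann G D n) 0 j u v)%C by ring.
        apply hres; lra.
    + pose proof (hexp y z ltac:(lra) ltac:(lra)).
      apply Rle_trans with (2 * (d / (2 * Lam)) * Lam). nra. right; field; lra.
Qed.

(** S solves the Goursat form of the equation up to d.  Subtracting this relation
    at (y, z) and at (y, - y) shows that it solves the Cauchy form up to 2 d, so
    that S and the exact solution Z can be compared from x = 0. *)
Lemma cauchy_stability (G : R -> C) (K c : R) (S Z : bool -> R -> R -> C) (d e : R) :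
  0 < K -> 0 <= c -> 0 <= d -> 0 <= e ->
  (forall r, continuous G r) -> (forall r, Cmod (G r) <= K) ->
  (forall i, jointly_continuous (S i)) -> (forall i, jointly_continuous (Z i)) ->
  (forall i y z, Rabs y <= c -> Rabs z <= c ->
      Cmod (S i y z - S i y 0 - volterra G S 0 i y z)%C <= d) ->
  (forall i y z, Rabs y <= c -> Rabs z <= c -> Rabs (y + z) <= c ->
      Z i y z = (Z i y (- y)%R + volterra G Z (- y)%R i y z)%C) ->
  (forall i y, Rabs y <= c -> Cmod (Z i y (- y)%R - S i y (- y)%R)%C <= e) ->
  forall i y z, Rabs y <= c -> Rabs z <= c -> Rabs (y + z) <= c ->
    Cmod (Z i y z - S i y z)%C <= 2 * (e + 2 * d) * exp (2 * K * c).
Proof.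
  intros hK hc hd he hG hGK hS hZ hres hmild hdata i y z hy hz hyz.
  assert (hE : forall i, jointly_continuous (fun y z => Z i y z - S i y z)%C).
  { intros j p. apply continuous_Cminus; [apply hZ | apply hS]. }
  destruct (family_bounded_on_box _ c hE) as (M' & hM' & hb).
  eapply Rle_trans.
  - apply (volterra_stability G K Ropp (fun _ => 0) (fun y z => Rabs (y + z))
        (fun y z => Rabs y <= c /\ Rabs z <= c /\ Rabs (y + z) <= c)
        (fun i y z => Z i y z - S i y z)%C M' (e + 2 * d) (cauchy_region c)); trivial; try lra.
    + intros u v _. apply Rabs_pos.
    + intros j u v (hu & hv & _). now apply hb.
    + intros j u v (hu & hv & huv). rewrite volterra_minus by trivial.
      rewrite (hmild j u v hu hv huv).
      assert (hch : (volterra G S 0 j u (- u)%R + volterra G S (- u)%R j u v)%C = volterra G S 0 j u v).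
      { apply CInt_Chasles. intros. now apply continuous_volterra_integrand. }
      pose proof (hres j u v hu hv) as r1.
      pose proof (hres j u (- u) hu ltac:(now rewrite Rabs_Ropp)) as r2.
      pose proof (hdata j u hu) as r3.
      rewrite <- hch in r1.
      match goal with |- Cmod ?A <= _ => replace A with
        ((Z j u (- u)%R - S j u (- u)%R) + (- (S j u v - S j u 0%R - (volterra G S 0 j u (- u)%R + volterra G S (- u)%R j u v))
         + (S j u (- u)%R - S j u 0%R - volterra G S 0 j u (- u)%R)))%C by ring end.
      eapply Rle_trans. apply Cmod_triangle.
      eapply Rle_trans. apply Rplus_le_compat_l, Cmod_triangle.
      rewrite Cmod_opp. lra.
  - apply Rmult_le_compat_l; [lra|].
    assert (h : 2 * K * Rabs (y + z) <= 2 * K * c) by (apply Rmult_le_compat_l; lra).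
    destruct h as [h|h]; [left; now apply exp_increasing | right; now rewrite h].
Qed.

(** * Finite sums and polynomials *)

(** As for [CInt], the value is typed as a complex number for the sake of [ring]. *)
Definition Csum (a : nat -> C) (n : nat) : C := sum_n (G := C_AbelianMonoid) a n.

Lemma Csum_S (a : nat -> C) (n : nat) : Csum a (S n) = (Csum a n + a (S n))%C.
Proof. apply (sum_Sn (G := C_AbelianMonoid) a n). Qed.

Lemma Csum_0 (a : nat -> C) : Csum a 0 = a 0%nat.
Proof. apply (sum_O (G := C_AbelianMonoid) a). Qed.

Lemma Csum_shift (a : nat -> C) (n : nat) :
  Csum a (S n) = (a 0%nat + Csum (fun k => a (S k)) n)%C.
Proof.
  induction n as [|n IH].
  - now rewrite Csum_S, !Csum_0.
  - rewrite Csum_S, IH, Csum_S. ring.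
Qed.

Lemma Csum_plus (a b : nat -> C) (n : nat) :
  Csum (fun k => a k + b k)%C n = (Csum a n + Csum b n)%C.
Proof. apply (sum_n_plus (G := C_AbelianMonoid) a b). Qed.

Lemma Csum_mult_l (c : C) (a : nat -> C) (n : nat) :
  Csum (fun k => c * a k)%C n = (c * Csum a n)%C.
Proof.
  induction n as [|n IH]; [now rewrite !Csum_0|]. rewrite !Csum_S, IH. ring.
Qed.

Lemma Csum_ext (a b : nat -> C) (n : nat) :
  (forall k, (k <= n)%nat -> a k = b k) -> Csum a n = Csum b n.
Proof. apply (sum_n_ext_loc (G := C_AbelianMonoid) a b). Qed.

Lemma is_derive_Csum (F dF : nat -> R -> C) n x :
  (forall k, is_derive (V := C_R_NormedModule) (F k) x (dF k x)) ->
  is_derive (V := C_R_NormedModule) (fun s => Csum (fun k => F k s) n) x (Csum (fun k => dF k x) n).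
Proof.
  intros h. induction n as [|n IH].
  - apply (is_derive_ext (F 0%nat)); [intros; now rewrite Csum_0 | now rewrite Csum_0].
  - apply (is_derive_ext (fun s => Csum (fun k => F k s) n + F (S n) s)%C); [intros; now rewrite Csum_S|].
    rewrite Csum_S. now apply is_derive_Cplus.
Qed.

Lemma continuous_Csum {U : UniformSpace} (F : nat -> U -> C) n x :
  (forall k, continuous (F k) x) -> continuous (fun s => Csum (fun k => F k s) n) x.
Proof.
  intros h. induction n as [|n IH].
  - apply (continuous_ext (F 0%nat)); [intros; now rewrite Csum_0 | trivial].
  - apply (continuous_ext (fun s => Csum (fun k => F k s) n + F (S n) s)%C); [intros; now rewrite Csum_S|].
    now apply continuous_Cplus.
Qed.

Definition polynomial_upto (N : nat) (P : R -> C) : Prop :=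
  exists c : nat -> C, forall t, P t = Csum (fun k => c k * RtoC (t ^ k))%C N.

Lemma polynomial_upto_plus N P Q :
  polynomial_upto N P -> polynomial_upto N Q -> polynomial_upto N (fun t => P t + Q t)%C.
Proof.
  intros [c hc] [d hd]. exists (fun k => c k + d k)%C. intros t.
  rewrite hc, hd, <- Csum_plus. apply Csum_ext. intros; ring.
Qed.

Lemma polynomial_upto_scal N (a : C) P :
  polynomial_upto N P -> polynomial_upto N (fun t => a * P t)%C.
Proof.
  intros [c hc]. exists (fun k => a * c k)%C. intros t.
  rewrite hc, <- Csum_mult_l. apply Csum_ext. intros; ring.
Qed.

Lemma polynomial_upto_weaken N P : polynomial_upto N P -> polynomial_upto (S N) P.
Proof.
  intros [c hc]. exists (fun k => if Nat.leb k N then c k else RtoC 0). intros t.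
  rewrite Csum_S, (proj2 (Nat.leb_gt (S N) N)) by lia.
  rewrite hc. transitivity (Csum (fun k => c k * RtoC (t ^ k))%C N + 0)%C; [ring|].
  f_equal; [|ring]. apply Csum_ext. intros k hk. now rewrite (proj2 (Nat.leb_le k N)).
Qed.

Lemma polynomial_upto_mult_X N P :
  polynomial_upto N P -> polynomial_upto (S N) (fun t => RtoC t * P t)%C.
Proof.
  intros [c hc]. exists (fun k => match k with O => RtoC 0 | S j => c j end). intros t.
  rewrite Csum_shift, hc, <- Csum_mult_l.
  rewrite Cmult_0_l, Cplus_0_l. apply Csum_ext. intros k _.
  rewrite <- tech_pow_Rmult, RtoC_mult. ring.
Qed.

(** * Bernstein approximation *)

(** The mean of phi under the binomial law with parameters N and p, for q = 1 - p.
    The recursion conditions on the first trial, so no binomial coefficient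
    appears and all properties follow by induction on N. *)
Fixpoint binomial_mean (p q : R) (N : nat) (phi : nat -> C) : C :=
  match N with
  | O => phi O
  | S m => (RtoC p * binomial_mean p q m (fun k => phi (S k)) + RtoC q * binomial_mean p q m phi)%C
  end.

Lemma binomial_mean_minus_const p q N phi (c : C) :
  p + q = 1 ->
  binomial_mean p q N (fun k => phi k - c)%C = (binomial_mean p q N phi - c)%C.
Proof.
  intros hpq. revert phi. induction N as [|N IH]; intros phi; simpl; trivial.
  rewrite (IH phi), (IH (fun k => phi (S k))).
  replace (RtoC q) with (1 - RtoC p)%C; [ring|]. rewrite <- RtoC_minus. f_equal. lra.
Qed.

(** The right-hand side is the mean of the bound, as Np and Npq are the expectation
    and the variance of the binomial law.  The centre a is left free because
    conditioning on the first trial moves it. *)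
Lemma binomial_mean_le_variance p q N phi A B a :
  0 <= p -> 0 <= q -> p + q = 1 ->
  (forall k, (k <= N)%nat -> Cmod (phi k) <= A + B * (INR k - a) ^ 2) ->
  Cmod (binomial_mean p q N phi) <= A + B * ((INR N * p - a) ^ 2 + INR N * p * q).
Proof.
  intros hp hq hpq. revert phi a. induction N as [|N IH]; intros phi a hphi.
  - specialize (hphi O (le_n 0)). simpl in *.
    replace ((0 * p - a) * ((0 * p - a) * 1) + 0 * p * q) with ((0 - a) * ((0 - a) * 1)) by ring.
    exact hphi.
  - assert (h1 : Cmod (binomial_mean p q N (fun k => phi (S k)))
      <= A + B * ((INR N * p - (a - 1)) ^ 2 + INR N * p * q)).
    { apply IH. intros k hk. specialize (hphi (S k) ltac:(lia)). rewrite S_INR in hphi.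
      replace (INR k - (a - 1)) with (INR k + 1 - a) by ring. exact hphi. }
    assert (h2 : Cmod (binomial_mean p q N phi) <= A + B * ((INR N * p - a) ^ 2 + INR N * p * q)).
    { apply IH. intros k hk. apply hphi. lia. }
    simpl binomial_mean. eapply Rle_trans; [apply Cmod_triangle|].
    rewrite !Cmod_mult, !Cmod_R, !Rabs_pos_eq by trivial.
    apply Rmult_le_compat_l with (r := p) in h1; trivial.
    apply Rmult_le_compat_l with (r := q) in h2; trivial.
    eapply Rle_trans; [apply Rplus_le_compat; [apply h1 | apply h2]|].
    right. rewrite S_INR. replace q with (1 - p) by lra. ring.
Qed.

Definition bernstein (c : R) (h : R -> C) (N : nat) (t : R) : C :=
  binomial_mean ((t + c) / (2 * c)) ((c - t) / (2 * c)) N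
    (fun k => h (2 * c * INR k / INR N - c)).

(** Both weights are affine in t, so each trial raises the degree by at most one. *)
Lemma polynomial_upto_bernstein c h N : 0 < c -> polynomial_upto N (bernstein c h N).
Proof.
  intros hc. unfold bernstein. generalize (fun k => h (2 * c * INR k / INR N - c)).
  induction N as [|N IH]; intros phi; simpl.
  - exists (fun _ => phi O). intros t. rewrite Csum_0. simpl. ring.
  - pose proof (IH (fun k => phi (S k))) as h1. pose proof (IH phi) as h2.
    pose proof (polynomial_upto_plus _ _ _
      (polynomial_upto_plus _ _ _
        (polynomial_upto_scal _ (RtoC (/ (2 * c))) _ (polynomial_upto_mult_X _ _ h1))
        (polynomial_upto_scal _ (RtoC (/ 2)) _ (polynomial_upto_weaken _ _ h1)))
      (polynomial_upto_plus _ _ _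
        (polynomial_upto_scal _ (RtoC (- / (2 * c))) _ (polynomial_upto_mult_X _ _ h2))
        (polynomial_upto_scal _ (RtoC (/ 2)) _ (polynomial_upto_weaken _ _ h2)))) as [d hd].
    exists d. intros t. rewrite <- hd.
    replace ((t + c) / (2 * c)) with (/ (2 * c) * t + / 2) by (field; lra).
    replace ((c - t) / (2 * c)) with (- / (2 * c) * t + / 2) by (field; lra).
    rewrite !RtoC_plus, !RtoC_mult. ring.
Qed.

(** Chebyshev's argument: near t the oscillation of h is small by uniform continuity,
    away from t it is at most 2 M <= Q (s - t)^2, and the variance of the nodes
    is of order 1 / N. *)
Lemma bernstein_approximation c (h : R -> C) (eps : R) :
  0 < c -> (forall t, continuous h t) -> 0 < eps ->
  exists N0 : nat, forall N, (N0 <= N)%nat -> forall t, - c <= t <= c ->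
    Cmod (bernstein c h N t - h t)%C <= eps.
Proof.
  intros hc hh heps.
  destruct (bounded_continuity (V := C_R_NormedModule) h (- c) c (fun t _ => hh t)) as [M hM].
  destruct (unifcont_normed_1d (V := C_R_NormedModule) h (- c) c (fun t _ => hh t)
    (mkposreal (eps / 2) ltac:(lra))) as [d hd].
  assert (hM0 : 0 <= M).
  { specialize (hM 0 ltac:(lra)). rewrite norm_Cmod in hM. pose proof (Cmod_ge_0 (h 0)). lra. }
  pose proof (cond_pos d) as hdpos.
  set (Q := 2 * M / d ^ 2).
  assert (hQ : 0 <= Q).
  { apply Rdiv_le_0_compat; [lra|]. apply pow_lt, hdpos. }
  (* The variance term is at most Q c^2 / N since p q <= 1/4. *)
  destruct (nfloor_ex (2 * Q * c ^ 2 / eps)) as [n0 hn0].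
  { apply Rdiv_le_0_compat; [|lra]. pose proof (pow2_ge_0 c). nra. }
  exists (S n0). intros N hN t ht.
  assert (hNR : 2 * Q * c ^ 2 / eps <= INR N).
  { apply le_INR in hN. rewrite S_INR in hN. lra. }
  assert (hNpos : 0 < INR N) by (apply lt_0_INR; lia).
  set (p := (t + c) / (2 * c)). set (q := (c - t) / (2 * c)).
  assert (hp : 0 <= p) by (apply Rdiv_le_0_compat; lra).
  assert (hq : 0 <= q) by (apply Rdiv_le_0_compat; lra).
  assert (hpq : p + q = 1) by (unfold p, q; field; lra).
  unfold bernstein. fold p q. rewrite <- binomial_mean_minus_const by trivial.
  apply Rle_trans with (eps / 2 + Q * (2 * c / INR N) ^ 2 * ((INR N * p - INR N * p) ^ 2 + INR N * p * q)).
  - apply binomial_mean_le_variance; trivial. intros k hk.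
    set (s := 2 * c * INR k / INR N - c).
    assert (hs : - c <= s <= c).
    { apply le_INR in hk. pose proof (pos_INR k).
      assert (0 <= INR k / INR N <= 1).
      { split; [apply Rdiv_le_0_compat; lra|]. apply Rle_div_l; lra. }
      replace s with (2 * c * (INR k / INR N) - c) by (unfold s; field; lra). nra. }
    replace (Q * (2 * c / INR N) ^ 2 * (INR k - INR N * p) ^ 2) with (Q * (s - t) ^ 2)
      by (unfold s, p; field; lra).
    destruct (Rlt_or_le (Rabs (s - t)) d) as [hst | hst].
    + specialize (hd t s ht hs hst). unfold ball_norm in hd. rewrite norm_Cmod in hd.
      change (Cmod (h s - h t)%C < eps / 2) in hd. pose proof (pow2_ge_0 (s - t)). nra.
    + apply Rle_trans with (2 * M).
      * eapply Rle_trans; [apply Cmod_triangle|]. rewrite Cmod_opp.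
        pose proof (hM s hs) as h1. pose proof (hM t ht) as h2. rewrite norm_Cmod in h1, h2. lra.
      * assert (d ^ 2 <= (s - t) ^ 2).
        { rewrite <- (pow2_abs (s - t)). apply pow_incr. lra. }
        replace (2 * M) with (Q * d ^ 2) by (unfold Q; field; lra). nra.
  - replace (Q * (2 * c / INR N) ^ 2 * ((INR N * p - INR N * p) ^ 2 + INR N * p * q))
      with (4 * Q * c ^ 2 * (p * q) / INR N) by (field; lra).
    assert (hpq4 : p * q <= / 4) by (replace q with (1 - p) by lra; pose proof (pow2_ge_0 (p - / 2)); lra).
    assert (4 * Q * c ^ 2 * (p * q) / INR N <= eps / 2); [|lra].
    apply Rle_div_l; trivial.
    apply Rle_div_l in hNR; trivial.
    pose proof (pow2_ge_0 c). assert (0 <= Q * c ^ 2) by nra. nra.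
Qed.

(** * The Vekua equation in characteristic coordinates *)

Lemma vekua_components (c : C) (u v ux ut vx vt : C) :
  Bminus (Bmult (CtoB (/ RtoC 2)) (Bminus (ux, vx) (Bmult Bj (ut, vt))))
    (Bmult (CtoB c) (Bconj (u, v))) = CtoB (RtoC 0)
  <-> (ux - vt = 2 * c * u /\ vx - ut = - (2 * c * v))%C.
Proof.
  assert (h2 : RtoC 2 <> RtoC 0) by (intros e; apply RtoC_inj in e; lra).
  unfold Bminus, Bmult, CtoB, Bj, Bconj; simpl. split.
  - intros h. pose proof (f_equal fst h) as h1. pose proof (f_equal snd h) as h3.
    simpl in h1, h3. split.
    + transitivity (2 * (/ 2 * (ux - (0 * ut + 1 * vt)) + 0 * (vx - (0 * vt + 1 * ut)) -
        (c * u + 0 * - v)) + 2 * c * u)%C; [field; trivial|]. rewrite h1. ring.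
    + transitivity (2 * (/ 2 * (vx - (0 * vt + 1 * ut)) + 0 * (ux - (0 * ut + 1 * vt)) -
        (c * - v + 0 * u)) - 2 * c * v)%C; [field; trivial|]. rewrite h3. ring.
  - intros [h1 h3]. apply injective_projections; simpl.
    + transitivity (/ 2 * ((ux - vt) - 2 * c * u))%C; [field; trivial|]. rewrite h1. ring.
    + transitivity (/ 2 * ((vx - ut) + 2 * c * v))%C; [field; trivial|]. rewrite h3. ring.
Qed.

Lemma vekua_solution_plus f f' D W1 W2 :
  vekua_solution f f' D W1 -> vekua_solution f f' D W2 ->
  vekua_solution f f' D (fun p => (fst (W1 p) + fst (W2 p), snd (W1 p) + snd (W2 p))%C).
Proof.
  intros (Wx1 & Wt1 & (hd1 & hx1 & ht1) & he1) (Wx2 & Wt2 & (hd2 & hx2 & ht2) & he2).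
  exists (fun p => (fst (Wx1 p) + fst (Wx2 p), snd (Wx1 p) + snd (Wx2 p))%C).
  exists (fun p => (fst (Wt1 p) + fst (Wt2 p), snd (Wt1 p) + snd (Wt2 p))%C).
  split; [split; [|split]|].
  - intros x t hp. destruct (hd1 x t hp), (hd2 x t hp). split;
    now apply (is_derive_plus (V := B_R_NormedModule)).
  - intros p hp. apply (filterlim_comp_2 Wx1 Wx2
      (plus (G := prod_NormedModule R_AbsRing C_R_NormedModule C_R_NormedModule)) (hx1 p hp) (hx2 p hp)).
    apply (filterlim_plus (V := B_R_NormedModule)).
  - intros p hp. apply (filterlim_comp_2 Wt1 Wt2
      (plus (G := prod_NormedModule R_AbsRing C_R_NormedModule C_R_NormedModule)) (ht1 p hp) (ht2 p hp)).
    apply (filterlim_plus (V := B_R_NormedModule)).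
  - intros p hp. specialize (he1 p hp). specialize (he2 p hp).
    unfold dzbar in *.
    rewrite (surjective_pairing (Wx1 p)), (surjective_pairing (Wt1 p)), (surjective_pairing (W1 p)) in he1.
    rewrite (surjective_pairing (Wx2 p)), (surjective_pairing (Wt2 p)), (surjective_pairing (W2 p)) in he2.
    apply vekua_components in he1, he2. apply vekua_components.
    destruct he1 as [h1 h2], he2 as [h3 h4]. split.
    + transitivity ((fst (Wx1 p) - snd (Wt1 p)) + (fst (Wx2 p) - snd (Wt2 p)))%C; [ring|].
      rewrite h1, h3. ring.
    + transitivity ((snd (Wx1 p) - fst (Wt1 p)) + (snd (Wx2 p) - fst (Wt2 p)))%C; [ring|].
      rewrite h2, h4. ring.
Qed.

Lemma vekua_solution_ext (f f' g g' : R -> C) (D : R * R -> Prop) (W W2 : R * R -> B) :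
  open D ->
  (forall p : R * R, D p -> f (fst p) = g (fst p) /\ f' (fst p) = g' (fst p)) ->
  (forall p : R * R, D p -> W p = W2 p) ->
  vekua_solution f f' D W -> vekua_solution g g' D W2.
Proof.
  intros hD hfg hW (Wx & Wt & (hd & hx & ht) & he).
  exists Wx, Wt. split; [split; [|split]|]; trivial.
  - intros x t hp. destruct (hd x t hp) as [h1 h2].
    assert (hloc : locally (x, t) D) by (now apply hD).
    destruct hloc as [e hloc]. split.
    + apply (is_derive_ext_loc (fun s => W (s, t))); trivial.
      exists e. intros s hs. apply hW, hloc. split; [apply hs | apply ball_center].
    + apply (is_derive_ext_loc (fun s => W (x, s))); trivial.
      exists e. intros s hs. apply hW, hloc. split; [apply ball_center | apply hs].
  - intros p hp. destruct (hfg p hp) as [h1 h2]. rewrite <- h1, <- h2, <- hW; trivial. now apply he.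
Qed.

(** The index true stands for u + v, transported along x + t = const, and false for
    u - v, transported along x - t = const. *)
Definition sgn (i : bool) : R := if i then 1 else - 1.

(** The first argument y is the coordinate that is constant along the transport of
    the component i, so that the two components play symmetric roles. *)
Definition char_point (i : bool) (y z : R) : R * R := ((y + z) / 2, sgn i * (y - z) / 2).

Definition char_component (W : R * R -> B) (i : bool) (y z : R) : C :=
  (fst (W (char_point i y z)) + RtoC (sgn i) * snd (W (char_point i y z)))%C.

Lemma char_point_swap i y z : char_point (negb i) z y = char_point i y z.
Proof. unfold char_point. destruct i; simpl; f_equal; field. Qed.

Lemma continuous_char_point i (p : R * R) :
  continuous (fun q : R * R => char_point i (fst q) (snd q)) p.
Proof.
  destruct p as [y z].
  apply (continuous_comp_2 (fun q : R * R => (fst q + snd q) / 2) (fun q => sgn i * (fst q - snd q) / 2)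
    (fun a b => (a, b))).
  - apply (continuous_mult (K := R_AbsRing)); [|apply continuous_const].
    apply (continuous_plus (V := R_NormedModule) fst snd); [apply continuous_fst | apply continuous_snd].
  - apply (continuous_mult (K := R_AbsRing)); [|apply continuous_const].
    apply (continuous_mult (K := R_AbsRing)); [apply continuous_const|].
    apply (continuous_minus (V := R_NormedModule) fst snd); [apply continuous_fst | apply continuous_snd].
  - apply (continuous_ext (fun u : R * R => u)); [now intros [? ?]|]. apply continuous_id.
Qed.

Lemma jointly_continuous_char_component (W : R * R -> B) i :
  (forall p, continuous (U := prod_UniformSpace C_UniformSpace C_UniformSpace) W p) ->
  jointly_continuous (char_component W i).
Proof.
  intros hW p. apply continuous_Cplus; [|apply continuous_Cmult; [apply continuous_const|]].
  - apply (continuous_comp (fun q : R * R => char_point i (fst q) (snd q)) (fun q => fst (W q))).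
    + apply continuous_char_point.
    + apply continuous_Bfst, hW.
  - apply (continuous_comp (fun q : R * R => char_point i (fst q) (snd q)) (fun q => snd (W q))).
    + apply continuous_char_point.
    + apply continuous_Bsnd, hW.
Qed.

(** The bicomplex norm is the mean of the moduli of u + v and u - v. *)
Lemma Bnorm_char_components (W1 W2 : R * R -> B) x t e :
  (forall i, Cmod (char_component W1 i (x + sgn i * t) (x - sgn i * t)
     - char_component W2 i (x + sgn i * t)%R (x - sgn i * t)%R)%C <= e) ->
  Bnorm (Bminus (W1 (x, t)) (W2 (x, t))) <= e.
Proof.
  intros h.
  assert (hp : forall i, char_point i (x + sgn i * t) (x - sgn i * t) = (x, t)).
  { intros i. unfold char_point. destruct i; simpl; f_equal; field. }
  pose proof (h true) as h1. pose proof (h false) as h2.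
  unfold char_component in h1, h2. rewrite !hp in h1, h2. simpl sgn in h1, h2.
  unfold Bnorm, Bminus. simpl fst. simpl snd.
  match goal with |- / 2 * (Cmod ?A + Cmod ?A') <= _ =>
   match type of h1 with Cmod ?B1 <= _ => replace A with B1 by ring end;
   match type of h2 with Cmod ?B2 <= _ => replace A' with B2 by (change (-1) with (- (1)); rewrite RtoC_opp; ring) end end.
  lra.
Qed.

(** In the derivative of u + e v along its characteristic, with e = sgn i, the
    partial derivatives occur only as u_x - v_t and e (v_x - u_t), which the
    equation replaces by g u and - e g v; the sum g (u - e v) is the other
    component. *)
Lemma vekua_characteristic_derivative (f f' : R -> C) D W i y z :
  open D -> (forall x t, D (x, t) -> f x <> RtoC 0) ->
  vekua_solution f f' D W -> D (char_point i y z) ->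
  is_derive (V := C_R_NormedModule) (char_component W i y) z
    (f' ((y + z) / 2)%R / f ((y + z) / 2)%R / 2 * char_component W (negb i) z y)%C.
Proof.
  intros hD hf (Wx & Wt & (hder & hWx & hWt) & heq) hp.
  assert (h2 : RtoC 2 <> RtoC 0) by (intros e; apply RtoC_inj in e; lra).
  set (x0 := (y + z) / 2). set (t0 := sgn i * (y - z) / 2).
  assert (hX : is_derive (fun s => (y + s) / 2) z (/ 2)) by (auto_derive; [easy | field]).
  assert (hT : is_derive (fun s => sgn i * (y - s) / 2) z (- sgn i / 2)) by (auto_derive; [easy | field]).
  assert (hloc : locally (x0, t0) D) by (apply hD, hp).
  destruct (hder x0 t0 hp) as [_ ht].
  assert (hu : is_derive (V := C_R_NormedModule) (fun s => fst (W (char_point i y s))) z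
    (RtoC (/ 2) * fst (Wx (x0, t0)) + RtoC (- sgn i / 2) * fst (Wt (x0, t0)))%C).
  { apply (is_derive_along_curve_C (fun p => fst (W p)) (fun p => fst (Wx p)) _
      (fun s => (y + s) / 2) (fun s => sgn i * (y - s) / 2)); trivial.
    - apply filter_imp with (2 := hloc). intros [x t] hxt.
      apply (is_derive_fst (U := C_R_NormedModule) (V := C_R_NormedModule) (fun s => W (s, t)) x).
      now apply hder.
    - apply (is_derive_fst (U := C_R_NormedModule) (V := C_R_NormedModule) (fun s => W (x0, s)) t0 _ ht).
    - apply continuous_Bfst. now apply (continuous_continuous_on D). }
  assert (hv : is_derive (V := C_R_NormedModule) (fun s => snd (W (char_point i y s))) z
    (RtoC (/ 2) * snd (Wx (x0, t0)) + RtoC (- sgn i / 2) * snd (Wt (x0, t0)))%C).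
  { apply (is_derive_along_curve_C (fun p => snd (W p)) (fun p => snd (Wx p)) _
      (fun s => (y + s) / 2) (fun s => sgn i * (y - s) / 2)); trivial.
    - apply filter_imp with (2 := hloc). intros [x t] hxt.
      apply (is_derive_snd (U := C_R_NormedModule) (V := C_R_NormedModule) (fun s => W (s, t)) x).
      now apply hder.
    - apply (is_derive_snd (U := C_R_NormedModule) (V := C_R_NormedModule) (fun s => W (x0, s)) t0 _ ht).
    - apply continuous_Bsnd. now apply (continuous_continuous_on D). }
  specialize (heq (x0, t0) hp). unfold dzbar in heq. simpl fst in heq.
  rewrite (surjective_pairing (Wx (x0, t0))), (surjective_pairing (Wt (x0, t0))),
    (surjective_pairing (W (x0, t0))) in heq.
  apply vekua_components in heq. destruct heq as [e1 e2].
  assert (hf0 : f x0 <> RtoC 0) by (apply (hf x0 t0), hp).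
  unfold char_component. rewrite char_point_swap. change (char_point i y z) with (x0, t0).
  match goal with |- is_derive _ _ ?l => replace l with
    ((RtoC (/ 2) * fst (Wx (x0, t0)) + RtoC (- sgn i / 2) * fst (Wt (x0, t0)))
     + RtoC (sgn i) * (RtoC (/ 2) * snd (Wx (x0, t0)) + RtoC (- sgn i / 2) * snd (Wt (x0, t0))))%C end.
  { apply is_derive_Cplus; trivial. now apply is_derive_Cscal. }
  assert (hss : sgn (negb i) = - sgn i) by (destruct i; simpl; ring).
  assert (hs2 : (RtoC (sgn i) * RtoC (sgn i) = 1)%C).
  { rewrite <- RtoC_mult. f_equal. destruct i; simpl; ring. }
  rewrite hss, RtoC_opp. unfold Rdiv. rewrite RtoC_mult, RtoC_opp, RtoC_inv by lra.
  revert hs2. generalize (RtoC (sgn i)). intros e he.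
  transitivity (/ 2 * (fst (Wx (x0, t0)) - e * e * snd (Wt (x0, t0)))
     + / 2 * e * (snd (Wx (x0, t0)) - fst (Wt (x0, t0))))%C; [ring|].
  rewrite he. rewrite Cmult_1_l, e1, e2. fold x0. field; auto.
Qed.

Definition char_coefficient (f f' : R -> C) (r : R) : C := (f' (r / 2)%R / f (r / 2)%R / 2)%C.

Lemma vekua_integral_equation (f f' : R -> C) (D : R * R -> Prop) (W : R * R -> B) i y z1 z2 :
  open D -> (forall x, f x <> RtoC 0) ->
  (forall r, continuous (char_coefficient f f') r) ->
  (forall p, continuous (U := prod_UniformSpace C_UniformSpace C_UniformSpace) W p) ->
  vekua_solution f f' D W ->
  (forall s, Rmin z1 z2 < s < Rmax z1 z2 -> D (char_point i y s)) ->
  char_component W i y z2 =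
    (char_component W i y z1 + volterra (char_coefficient f f') (char_component W) z1 i y z2)%C.
Proof.
  intros hD hf0 hG hW hv hpath. unfold volterra.
  rewrite (CInt_derive (char_component W i y)); [ring | | |].
  - intros s.
    apply (continuous_comp_2 (fun _ => y) (fun s => s) (char_component W i)).
    + apply continuous_const.
    + apply continuous_id.
    + now apply jointly_continuous_char_component.
  - intros s. apply continuous_volterra_integrand; trivial.
    now apply jointly_continuous_char_component.
  - intros s hs. apply (vekua_characteristic_derivative f f' D); trivial.
    now apply hpath.
Qed.

(** * The functions phi_k and psi_k *)

(** Derivatives are taken inside (-b, b) only: a function frozen beyond the endpoints
    is continuous on the line but has corners at -b and b. *)
Definition coefficient_extension (b : R) (f f' : R -> C) : Prop :=
  (forall x, continuous f x) /\ (forall x, continuous f' x) /\ (forall x, f x <> RtoC 0) /\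
  (forall x, - b < x < b -> is_derive (V := C_R_NormedModule) f x (f' x)).

Lemma continuous_Csignpow (f : R -> C) n (x : R) :
  (forall x, continuous f x) -> (forall x, f x <> RtoC 0) ->
  continuous (fun s => Csignpow (f s * f s)%C n) x.
Proof.
  intros hf hf0. unfold Csignpow. destruct (Nat.even n).
  - now apply continuous_Cmult.
  - apply continuous_Cinv; [now apply continuous_Cmult|]. now apply Cmult_neq_0.
Qed.

Lemma is_derive_X_integral (f : R -> C) (h : R -> C) (n m : nat) x :
  (forall x, continuous f x) -> (forall x, f x <> RtoC 0) -> (forall x, continuous h x) ->
  is_derive (V := C_R_NormedModule)
    (fun x => RtoC (INR n) * CInt (fun s => h s * Csignpow (f s * f s) m) 0 x)%C x
    (RtoC (INR n) * (h x * Csignpow (f x * f x) m))%C.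
Proof.
  intros hf hf0 hh. apply is_derive_Cscal.
  apply (is_derive_CInt (fun s => h s * Csignpow (f s * f s) m)%C).
  intros s. apply continuous_Cmult; trivial. now apply continuous_Csignpow.
Qed.

Lemma continuous_X (f : R -> C) k :
  (forall x, continuous f x) -> (forall x, f x <> RtoC 0) -> forall x, continuous (X f k) x.
Proof.
  intros hf hf0. induction k as [|k IH]; intros x.
  - apply continuous_const.
  - apply (ex_derive_continuous (V := C_R_NormedModule)). eexists.
    now apply (is_derive_X_integral f (X f k) (S k) (S k)).
Qed.

Lemma continuous_Xt (f : R -> C) k :
  (forall x, continuous f x) -> (forall x, f x <> RtoC 0) -> forall x, continuous (Xt f k) x.
Proof.
  intros hf hf0. induction k as [|k IH]; intros x.
  - apply continuous_const.
  - apply (ex_derive_continuous (V := C_R_NormedModule)). eexists.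
    now apply (is_derive_X_integral f (Xt f k) (S k) k).
Qed.

Lemma is_derive_X_S (f : R -> C) k (x : R) :
  (forall x, continuous f x) -> (forall x, f x <> RtoC 0) ->
  is_derive (V := C_R_NormedModule) (X f (S k)) x
    (RtoC (INR (S k)) * (X f k x * Csignpow (f x * f x) (S k)))%C.
Proof.
  intros hf hf0. apply (is_derive_X_integral f (X f k) (S k) (S k)); trivial.
  now apply continuous_X.
Qed.

Lemma is_derive_Xt_S (f : R -> C) k (x : R) :
  (forall x, continuous f x) -> (forall x, f x <> RtoC 0) ->
  is_derive (V := C_R_NormedModule) (Xt f (S k)) x
    (RtoC (INR (S k)) * (Xt f k x * Csignpow (f x * f x) k))%C.
Proof.
  intros hf hf0. apply (is_derive_X_integral f (Xt f k) (S k) k); trivial.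
  now apply continuous_Xt.
Qed.

Lemma continuous_phi (f : R -> C) k (x : R) :
  (forall x, continuous f x) -> (forall x, f x <> RtoC 0) -> continuous (phi f k) x.
Proof.
  intros hf hf0. unfold phi. destruct (Nat.odd k); apply continuous_Cmult; trivial;
  [now apply continuous_X | now apply continuous_Xt].
Qed.

Lemma continuous_psi (f : R -> C) k (x : R) :
  (forall x, continuous f x) -> (forall x, f x <> RtoC 0) -> continuous (psi f k) x.
Proof.
  intros hf hf0. unfold psi. destruct (Nat.odd k); apply continuous_Cmult;
  [now apply continuous_Xt | now apply continuous_Cinv | now apply continuous_X | now apply continuous_Cinv].
Qed.

(** With P_k = phi_k / f and Q_k = f psi_k the recursive integrals read
    P_k' = k Q_(k-1) / f^2 and Q_k' = k f^2 P_(k-1), whatever the parity of k. *)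
Lemma is_derive_phi b f f' k x :
  coefficient_extension b f f' -> - b < x < b ->
  is_derive (V := C_R_NormedModule) (phi f k) x
    (f' x / f x * phi f k x + RtoC (INR k) * psi f (pred k) x)%C.
Proof.
  intros (hf & _ & hf0 & hfd) hx.
  specialize (hfd x hx). pose proof (hf0 x) as hfx.
  destruct k as [|k].
  - unfold phi, psi; simpl. rewrite Cmult_1_r.
    apply (is_derive_ext f). { intros; simpl. now rewrite Cmult_1_r. }
    replace (f' x / f x * f x + 0 * (1 / f x))%C with (f' x); trivial. field; trivial.
  - simpl pred. unfold phi, psi. rewrite Nat.odd_succ, <- Nat.negb_even.
    destruct (Nat.even k) eqn:ek; simpl negb; cbv iota.
    + pose proof (is_derive_Cmult _ _ _ _ _ hfd (is_derive_X_S f k x hf hf0)) as h.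
      unfold Csignpow in h. rewrite Nat.even_succ, <- Nat.negb_even, ek in h. simpl negb in h. cbv iota in h.
      match type of h with is_derive _ _ ?u => match goal with |- is_derive _ _ ?v =>
        replace v with u; [exact h | field; trivial] end end.
    + pose proof (is_derive_Cmult _ _ _ _ _ hfd (is_derive_Xt_S f k x hf hf0)) as h.
      unfold Csignpow in h. rewrite ek in h.
      match type of h with is_derive _ _ ?u => match goal with |- is_derive _ _ ?v =>
        replace v with u; [exact h | field; trivial] end end.
Qed.

Lemma is_derive_psi b f f' k x :
  coefficient_extension b f f' -> - b < x < b ->
  is_derive (V := C_R_NormedModule) (psi f k) x
    (- (f' x / f x) * psi f k x + RtoC (INR k) * phi f (pred k) x)%C.
Proof.
  intros (hf & _ & hf0 & hfd) hx.
  pose proof (hf0 x) as hfx.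
  pose proof (is_derive_Cinv f x _ (hfd x hx) hfx) as hinv.
  destruct k as [|k].
  - unfold phi, psi; simpl.
    pose proof (is_derive_Cmult _ _ _ _ _ (is_derive_Cconst (RtoC 1) x) hinv) as h.
    match type of h with is_derive _ _ ?u => match goal with |- is_derive _ _ ?v =>
        replace v with u; [exact h | field; trivial] end end.
  - simpl pred. unfold phi, psi. rewrite Nat.odd_succ, <- Nat.negb_even.
    destruct (Nat.even k) eqn:ek; simpl negb; cbv iota.
    + pose proof (is_derive_Cmult _ _ _ _ _ (is_derive_Xt_S f k x hf hf0) hinv) as h.
      unfold Csignpow in h. rewrite ek in h.
      match type of h with is_derive _ _ ?u => match goal with |- is_derive _ _ ?v =>
        replace v with u; [exact h | field; trivial] end end.
    + pose proof (is_derive_Cmult _ _ _ _ _ (is_derive_X_S f k x hf hf0) hinv) as h.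
      unfold Csignpow in h. rewrite Nat.even_succ, <- Nat.negb_even, ek in h. simpl negb in h. cbv iota in h.
      match type of h with is_derive _ _ ?u => match goal with |- is_derive _ _ ?v =>
        replace v with u; [exact h | field; trivial] end end.
Qed.

Lemma X_ext b f g k :
  (forall x, - b <= x <= b -> f x = g x) -> forall x, - b <= x <= b -> X f k x = X g k x.
Proof.
  intros h. induction k as [|k IH]; intros x hx; simpl X; trivial.
  f_equal. apply (CInt_ext (fun s => X f k s * Csignpow (f s * f s) (S k))%C
    (fun s => X g k s * Csignpow (g s * g s) (S k))%C).
  intros s hs.
  assert (hs' : - b <= s <= b) by (unfold Rmin, Rmax in hs; destruct (Rle_dec 0 x); lra).
  now rewrite (IH s hs'), (h s hs').
Qed.

Lemma Xt_ext b f g k :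
  (forall x, - b <= x <= b -> f x = g x) -> forall x, - b <= x <= b -> Xt f k x = Xt g k x.
Proof.
  intros h. induction k as [|k IH]; intros x hx; simpl Xt; trivial.
  f_equal. apply (CInt_ext (fun s => Xt f k s * Csignpow (f s * f s) k)%C
    (fun s => Xt g k s * Csignpow (g s * g s) k)%C).
  intros s hs.
  assert (hs' : - b <= s <= b) by (unfold Rmin, Rmax in hs; destruct (Rle_dec 0 x); lra).
  now rewrite (IH s hs'), (h s hs').
Qed.

Lemma X_at_0 f k : X f (S k) 0 = RtoC 0.
Proof.
  change (RtoC (INR (S k)) * CInt (fun s => X f k s * Csignpow (f s * f s) (S k))%C 0 0 = 0)%C.
  rewrite CInt_point. ring.
Qed.

Lemma Xt_at_0 f k : Xt f (S k) 0 = RtoC 0.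
Proof.
  change (RtoC (INR (S k)) * CInt (fun s => Xt f k s * Csignpow (f s * f s) k)%C 0 0 = 0)%C.
  rewrite CInt_point. ring.
Qed.

Lemma phi_at_0 f k : f 0 = RtoC 1 -> phi f k 0 = if Nat.eqb k 0 then RtoC 1 else RtoC 0.
Proof.
  intros hf. unfold phi. rewrite hf. destruct k as [|k].
  - simpl. ring.
  - rewrite X_at_0, Xt_at_0. simpl Nat.eqb. destruct (Nat.odd (S k)); ring.
Qed.

Lemma psi_at_0 f k : f 0 = RtoC 1 -> psi f k 0 = if Nat.eqb k 0 then RtoC 1 else RtoC 0.
Proof.
  intros hf. unfold psi. rewrite hf. destruct k as [|k].
  - simpl. field.
  - rewrite X_at_0, Xt_at_0. simpl Nat.eqb. destruct (Nat.odd (S k)); field.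
Qed.

(** * Formal powers *)

(** The coefficient of j^k a over 1; that over j is obtained from k + 1. *)
Definition twisted_coef (a : B) (k : nat) : C := if Nat.even k then fst a else snd a.

(** With c = twisted_coef a this is the part over 1 of a formal power: the
    parity conditions in the sums u_n and v_n are absorbed into the
    coefficients, so that one sum replaces the two indexed by 2n - 1 and 2n. *)
Definition binomial_wave (n : nat) (c : nat -> C) (h : nat -> C) (t : R) : C :=
  Csum (fun k => RtoC (Binomial.C n k) * c k * h (n - k)%nat * RtoC (t ^ k))%C n.

Definition binomial_wave_t (n : nat) (c : nat -> C) (h : nat -> C) (t : R) : C :=
  Csum (fun k => RtoC (Binomial.C n k) * c k * h (n - k)%nat * RtoC (INR k * t ^ pred k))%C n.

Lemma wave_odd g n x t : (0 < n)%nat ->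
  wave g (2 * n - 1) x t = Csum (fun k => if Nat.even k
     then (RtoC (Binomial.C n k) * g (n - k)%nat x * RtoC (t ^ k))%C else RtoC 0) n.
Proof.
  intros hn. unfold wave.
  destruct (2 * n - 1)%nat as [|j] eqn:e; [lia|].
  replace (Nat.div2 (S (S j))) with n.
  2:{ replace (S (S j)) with (2 * n)%nat by lia. now rewrite Nat.div2_double. }
  replace (Nat.odd (S j)) with true.
  2:{ replace (S j) with (2 * (n - 1) + 1)%nat by lia. now rewrite Nat.odd_odd. }
  apply Csum_ext. intros k _. now destruct (Nat.even k).
Qed.

Lemma wave_even g n x t : (0 < n)%nat ->
  wave g (2 * n) x t = Csum (fun k => if Nat.even k then RtoC 0
     else (RtoC (Binomial.C n k) * g (n - k)%nat x * RtoC (t ^ k))%C) n.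
Proof.
  intros hn. unfold wave.
  destruct (2 * n)%nat as [|j] eqn:e; [lia|].
  replace (Nat.div2 (S (S j))) with n.
  2:{ rewrite <- e. now rewrite Nat.div2_succ_double. }
  replace (Nat.odd (S j)) with false.
  2:{ rewrite <- e. now rewrite Nat.odd_even. }
  apply Csum_ext. intros k _. now destruct (Nat.even k).
Qed.

Lemma Zformal_binomial_wave f n a x t :
  Zformal f n a (x, t) =
    (binomial_wave n (twisted_coef a) (fun j => phi f j x) t,
     binomial_wave n (fun k => twisted_coef a (S k)) (fun j => psi f j x) t).
Proof.
  destruct a as [a' a'']. unfold Zformal, u_, v_, binomial_wave, twisted_coef.
  destruct n as [|n].
  - rewrite !Csum_0. simpl. replace (Binomial.C 0 0) with 1 by (unfold Binomial.C; simpl; field).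
    f_equal; ring.
  - rewrite !wave_odd, !wave_even by lia.
    apply injective_projections; cbn [fst snd];
      rewrite <- !Csum_mult_l, <- Csum_plus; apply Csum_ext; intros k _;
      rewrite ?Nat.even_succ, <- ?Nat.negb_even; destruct (Nat.even k); simpl negb; cbv iota; ring.
Qed.

(** Binomial identity (n - k) C(n, k) = (k + 1) C(n, k + 1), with the index moved by
    one; the terms k = n on the left and k = 0 on the right vanish. *)
Lemma binomial_wave_shift n c h t :
  Csum (fun k => RtoC (Binomial.C n k) * c k * (RtoC (INR (n - k)) * h (pred (n - k))) * RtoC (t ^ k))%C n
  = Csum (fun k => RtoC (Binomial.C n k) * c (pred k) * h (n - k)%nat * RtoC (INR k * t ^ pred k))%C n.
Proof.
  destruct n as [|n].
  - rewrite !Csum_0. simpl. rewrite Rmult_0_l. ring.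
  - rewrite Csum_S, Csum_shift. rewrite Nat.sub_diag.
    change (INR 0) with 0. rewrite Rmult_0_l, !Cmult_0_l, !Cmult_0_r, Cplus_0_l, Cmult_0_l, Cplus_0_r.
    apply Csum_ext. intros k hk. change (pred (S k)) with k.
    replace (pred (S n - k)) with (S n - S k)%nat by lia.
    rewrite (pascal_step3 (S n) k) by lia.
    assert (hSk : INR (S k) <> 0) by (apply not_0_INR; lia).
    rewrite !RtoC_mult. unfold Rdiv. rewrite RtoC_mult, RtoC_inv by trivial.
    assert (hSk' : RtoC (INR (S k)) <> RtoC 0) by (intros e; apply RtoC_inj in e; lra).
    field. trivial.
Qed.

(** The x-derivatives of phi_j and psi_j have the form g h1_j + j h2_(j-1).  After
    summation the second term becomes a t-derivative, which is what balances
    the Vekua equation. *)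
Lemma binomial_wave_ladder n c (g : C) (h1 h2 : nat -> C) t :
  binomial_wave n c (fun j => g * h1 j + RtoC (INR j) * h2 (pred j))%C t
  = (g * binomial_wave n c h1 t + binomial_wave_t n (fun k => c (pred k)) h2 t)%C.
Proof.
  unfold binomial_wave_t. rewrite <- (binomial_wave_shift n c h2 t).
  unfold binomial_wave. rewrite <- Csum_mult_l, <- Csum_plus.
  apply Csum_ext. intros k _. ring.
Qed.

Lemma binomial_wave_unit n c (h : nat -> C) t :
  (forall j, h j = if Nat.eqb j 0 then RtoC 1 else RtoC 0) ->
  binomial_wave n c h t = (c n * RtoC (t ^ n))%C.
Proof.
  intros hh. unfold binomial_wave.
  assert (hCnn : Binomial.C n n = 1).
  { unfold Binomial.C. rewrite Nat.sub_diag. simpl. field. apply INR_fact_neq_0. }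
  destruct n as [|n].
  - rewrite Csum_0, hCnn, hh. simpl. ring.
  - rewrite Csum_S, hCnn, Nat.sub_diag, hh.
    rewrite (Csum_ext _ (fun k => RtoC 0 * RtoC 0)%C).
    + rewrite Csum_mult_l. simpl Nat.eqb. cbv iota. ring.
    + intros k hk. rewrite hh. replace (Nat.eqb (S n - k) 0) with false.
      * ring.
      * symmetry. apply Nat.eqb_neq. lia.
Qed.

Lemma is_derive_binomial_wave_x n c (h : nat -> R -> C) (dh : nat -> C) (x t : R) :
  (forall j, is_derive (V := C_R_NormedModule) (h j) x (dh j)) ->
  is_derive (V := C_R_NormedModule) (fun s => binomial_wave n c (fun j => h j s) t) x
    (binomial_wave n c dh t).
Proof.
  intros hd. unfold binomial_wave.
  apply (is_derive_Csum (fun k s => RtoC (Binomial.C n k) * c k * h (n - k)%nat s * RtoC (t ^ k))%C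
    (fun k _ => RtoC (Binomial.C n k) * c k * dh (n - k)%nat * RtoC (t ^ k))%C).
  intros k.
  match goal with |- is_derive _ _ ?l => replace l with
    (RtoC (Binomial.C n k) * c k * dh (n - k)%nat * RtoC (t ^ k)
     + RtoC (Binomial.C n k) * c k * h (n - k)%nat x * RtoC 0)%C by ring end.
  apply (is_derive_Cmult (fun s => RtoC (Binomial.C n k) * c k * h (n - k)%nat s)%C (fun _ => RtoC (t ^ k)));
    [|apply is_derive_Cconst].
  now apply (is_derive_Cscal (RtoC (Binomial.C n k) * c k)%C (h (n - k)%nat)).
Qed.

Lemma is_derive_binomial_wave_t n c (h : nat -> C) (t : R) :
  is_derive (V := C_R_NormedModule) (binomial_wave n c h) t (binomial_wave_t n c h t).
Proof.
  apply (is_derive_Csum (fun k s => RtoC (Binomial.C n k) * c k * h (n - k)%nat * RtoC (s ^ k))%C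
    (fun k s => RtoC (Binomial.C n k) * c k * h (n - k)%nat * RtoC (INR k * s ^ pred k))%C).
  intros k. apply is_derive_Cscal. apply is_derive_Cpair; [|apply (is_derive_const (V := R_NormedModule) 0)].
  replace (INR k * t ^ pred k) with (INR k * 1 * t ^ pred k) by ring.
  apply (is_derive_pow (fun s => s)), (is_derive_id (K := R_AbsRing)).
Qed.

Lemma continuous_in_x (h : R -> C) (p : R * R) :
  (forall x, continuous h x) -> continuous (fun q : R * R => h (fst q)) p.
Proof.
  intros hh. apply (continuous_comp fst h); [|apply hh]. destruct p. apply continuous_fst.
Qed.

Lemma continuous_in_t (h : R -> R) (p : R * R) :
  (forall t, ex_derive h t) -> continuous (fun q : R * R => RtoC (h (snd q))) p.
Proof.
  intros hh. apply continuous_RtoC. apply (continuous_comp snd h).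
  - destruct p. apply continuous_snd.
  - apply (ex_derive_continuous h), hh.
Qed.

Lemma ex_derive_monomial (r : R) (k : nat) (t : R) : ex_derive (fun t => r * t ^ k) t.
Proof. auto_derive. easy. Qed.

Lemma continuous_binomial_wave n c (h : nat -> R -> C) (p : R * R) :
  (forall j x, continuous (h j) x) ->
  continuous (fun q : R * R => binomial_wave n c (fun j => h j (fst q)) (snd q)) p.
Proof.
  intros hh.
  apply (continuous_Csum (fun k (q : R * R) =>
    RtoC (Binomial.C n k) * c k * h (n - k)%nat (fst q) * RtoC (snd q ^ k))%C).
  intros k. apply continuous_Cmult; [apply continuous_Cmult; [apply continuous_const|]|].
  - now apply continuous_in_x.
  - apply (continuous_in_t (fun t => t ^ k)). intros t. auto_derive. easy.
Qed.

Lemma continuous_binomial_wave_t n c (h : nat -> R -> C) (p : R * R) :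
  (forall j x, continuous (h j) x) ->
  continuous (fun q : R * R => binomial_wave_t n c (fun j => h j (fst q)) (snd q)) p.
Proof.
  intros hh.
  apply (continuous_Csum (fun k (q : R * R) =>
    RtoC (Binomial.C n k) * c k * h (n - k)%nat (fst q) * RtoC (INR k * snd q ^ pred k))%C).
  intros k. apply continuous_Cmult; [apply continuous_Cmult; [apply continuous_const|]|].
  - now apply continuous_in_x.
  - apply (continuous_in_t (fun t => INR k * t ^ pred k)). apply ex_derive_monomial.
Qed.

Lemma open_interval (b : R) : open (fun x : R => - b < x < b).
Proof. apply open_and; [apply open_gt | apply open_lt]. Qed.

Lemma open_open_square b : open (open_square b).
Proof.
  apply open_and.
  - apply (open_comp fst (fun x => - b < x < b)); [|apply open_interval].
    intros [x t] _. apply continuous_fst.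
  - apply (open_comp snd (fun x => - b < x < b)); [|apply open_interval].
    intros [x t] _. apply continuous_snd.
Qed.

Definition open_strip (b : R) (p : R * R) : Prop := - b < fst p < b.

Lemma open_open_strip b : open (open_strip b).
Proof.
  apply (open_comp fst (fun x => - b < x < b)); [|apply open_interval].
  intros [x t] _. apply continuous_fst.
Qed.

Lemma vekua_Zformal b f f' n a :
  coefficient_extension b f f' ->
  vekua_solution f f' (open_strip b) (Zformal f n a).
Proof.
  intros hfe. pose proof hfe as (hf & hf' & hf0 & hfd).
  set (dphi := fun j x => (f' x / f x * phi f j x + RtoC (INR j) * psi f (pred j) x)%C).
  set (dpsi := fun j x => (- (f' x / f x) * psi f j x + RtoC (INR j) * phi f (pred j) x)%C).
  assert (hg : forall x, continuous (fun x => f' x / f x)%C x).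
  { intros x. apply continuous_Cmult; [apply hf'|]. now apply continuous_Cinv. }
  assert (hphi : forall j x, continuous (phi f j) x) by (intros; now apply continuous_phi).
  assert (hpsi : forall j x, continuous (psi f j) x) by (intros; now apply continuous_psi).
  assert (hdphi : forall j x, continuous (dphi j) x).
  { intros j x. apply continuous_Cplus; apply continuous_Cmult;
      [apply hg | apply hphi | apply continuous_const | apply hpsi]. }
  assert (hdpsi : forall j x, continuous (dpsi j) x).
  { intros j x. apply continuous_Cplus; apply continuous_Cmult;
      [apply (continuous_opp (V := C_R_NormedModule) (fun x => f' x / f x)%C), hg | apply hpsi
      | apply continuous_const | apply hphi]. }
  set (c := twisted_coef a). set (d := fun k => twisted_coef a (S k)).
  exists (fun p => (binomial_wave n c (fun j => dphi j (fst p)) (snd p),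
                    binomial_wave n d (fun j => dpsi j (fst p)) (snd p))).
  exists (fun p => (binomial_wave_t n c (fun j => phi f j (fst p)) (snd p),
                    binomial_wave_t n d (fun j => psi f j (fst p)) (snd p))).
  split; [split; [|split]|].
  - intros x t hx. split.
    + apply (is_derive_ext (fun s => (binomial_wave n c (fun j => phi f j s) t,
        binomial_wave n d (fun j => psi f j s) t))).
      { intros s. symmetry. apply Zformal_binomial_wave. }
      apply (is_derive_pair (U := C_R_NormedModule) (V := C_R_NormedModule)).
      * apply (is_derive_binomial_wave_x n c (phi f)). intros j. now apply (is_derive_phi b).
      * apply (is_derive_binomial_wave_x n d (psi f)). intros j. now apply (is_derive_psi b).
    + apply (is_derive_ext (fun s => (binomial_wave n c (fun j => phi f j x) s,
        binomial_wave n d (fun j => psi f j x) s))).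
      { intros s. symmetry. apply Zformal_binomial_wave. }
      apply (is_derive_pair (U := C_R_NormedModule) (V := C_R_NormedModule));
        apply is_derive_binomial_wave_t.
  - apply continuous_on_forall. intros p _.
    apply continuous_Bpair; now apply continuous_binomial_wave.
  - apply continuous_on_forall. intros p _.
    apply continuous_Bpair; now apply continuous_binomial_wave_t.
  - intros [x t] hx. unfold dzbar. rewrite Zformal_binomial_wave. simpl fst. simpl snd.
    apply vekua_components. unfold dphi, dpsi. fold c. change (fun k => c (S k)) with d.
    rewrite (binomial_wave_ladder n c (f' x / f x)%C (fun j => phi f j x) (fun j => psi f j x)).
    rewrite (binomial_wave_ladder n d (- (f' x / f x))%C (fun j => psi f j x) (fun j => phi f j x)).
    pose proof (hf0 x) as hfx.
    assert (h2 : RtoC 2 <> RtoC 0) by (intros e; apply RtoC_inj in e; lra).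
    split.
    + replace (binomial_wave_t n (fun k => c (pred k)) (fun j => psi f j x) t)
        with (binomial_wave_t n d (fun j => psi f j x) t).
      * field. auto.
      * apply Csum_ext. intros [|k] _; [simpl; rewrite Rmult_0_l; ring|]. reflexivity.
    + replace (binomial_wave_t n (fun k => d (pred k)) (fun j => phi f j x) t)
        with (binomial_wave_t n c (fun j => phi f j x) t).
      * field. auto.
      * apply Csum_ext. intros [|k] _; [simpl; rewrite Rmult_0_l; ring|]. reflexivity.
Qed.

Lemma Zpoly_components f a N z :
  Zpoly f a N z = (Csum (fun n => fst (Zformal f n (a n) z)) N, Csum (fun n => snd (Zformal f n (a n) z)) N).
Proof.
  induction N as [|N IH].
  - rewrite !Csum_0. unfold Zpoly. rewrite sum_O. now destruct (Zformal f 0 (a 0%nat) z).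
  - rewrite !Csum_S. unfold Zpoly in *. rewrite sum_Sn, IH. reflexivity.
Qed.

(** The formal powers solve the equation on the whole strip |x| < b, not only in the
    square, which is what allows data on x = 0 with |t| up to 2b. *)
Lemma vekua_Zpoly b f f' a N :
  coefficient_extension b f f' ->
  vekua_solution f f' (open_strip b) (Zpoly f a N).
Proof.
  intros hf. induction N as [|N IH].
  - replace (Zpoly f a 0) with (Zformal f 0 (a 0%nat)); [now apply vekua_Zformal|].
    apply functional_extensionality. intros z.
    unfold Zpoly. now rewrite sum_O.
  - replace (Zpoly f a (S N)) with (fun p => (fst (Zpoly f a N p) + fst (Zformal f (S N) (a (S N)) p),
      snd (Zpoly f a N p) + snd (Zformal f (S N) (a (S N)) p))%C).
    + apply vekua_solution_plus; trivial. now apply vekua_Zformal.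
    + apply functional_extensionality. intros z.
      unfold Zpoly. now rewrite sum_Sn.
Qed.

Lemma continuous_Zpoly b f f' a N p :
  coefficient_extension b f f' ->
  continuous (U := prod_UniformSpace C_UniformSpace C_UniformSpace) (Zpoly f a N) p.
Proof.
  intros (hf & _ & hf0 & _).
  apply (continuous_ext (fun z => (Csum (fun n => fst (Zformal f n (a n) z)) N,
    Csum (fun n => snd (Zformal f n (a n) z)) N))).
  { intros z. symmetry. apply Zpoly_components. }
  apply continuous_Bpair; apply continuous_Csum; intros k.
  - apply (continuous_ext (fun z => binomial_wave k (twisted_coef (a k)) (fun j => phi f j (fst z)) (snd z))).
    { intros [x t]. now rewrite Zformal_binomial_wave. }
    apply continuous_binomial_wave. intros; now apply continuous_phi.
  - apply (continuous_ext (fun z => binomial_wave k (fun n => twisted_coef (a k) (S n)) (fun j => psi f j (fst z)) (snd z))).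
    { intros [x t]. now rewrite Zformal_binomial_wave. }
    apply continuous_binomial_wave. intros; now apply continuous_psi.
Qed.

(** At x = 0 only phi_0 = psi_0 = 1 survive, so the n-th formal power reduces to
    j^n a_n t^n; the factor j^n exchanges the two coefficients for odd n. *)
Lemma Zpoly_cauchy_data f N (P Q : R -> C) :
  f 0 = RtoC 1 -> polynomial_upto N P -> polynomial_upto N Q ->
  exists a, forall t, Zpoly f a N (0, t) = (P t, Q t).
Proof.
  intros hf [p hp] [q hq].
  exists (fun n => if Nat.even n then (p n, q n) else (q n, p n)). intros t.
  rewrite Zpoly_components, hp, hq.
  f_equal; apply Csum_ext; intros k _; rewrite Zformal_binomial_wave; simpl;
  rewrite binomial_wave_unit.
  - unfold twisted_coef. now destruct (Nat.even k).
  - intros j. now apply phi_at_0.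
  - unfold twisted_coef. rewrite Nat.even_succ, <- Nat.negb_even. now destruct (Nat.even k).
  - intros j. now apply psi_at_0.
Qed.

Lemma Zpoly_ext b f g a N x t :
  (forall x, - b <= x <= b -> f x = g x) -> - b <= x <= b ->
  Zpoly f a N (x, t) = Zpoly g a N (x, t).
Proof.
  intros h hx. rewrite !Zpoly_components.
  assert (hphi : forall j, phi f j x = phi g j x).
  { intros j. unfold phi. now rewrite (h x hx), (X_ext b f g), (Xt_ext b f g). }
  assert (hpsi : forall j, psi f j x = psi g j x).
  { intros j. unfold psi. now rewrite (h x hx), (X_ext b f g), (Xt_ext b f g). }
  f_equal; apply Csum_ext; intros k _; rewrite !Zformal_binomial_wave; simpl;
  apply Csum_ext; intros j _; [now rewrite hphi | now rewrite hpsi].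
Qed.

(** * Extension of the data beyond the square *)

Definition clamp (b x : R) : R := Rmax (- b) (Rmin b x).

Lemma clamp_bounds b x : 0 < b -> - b <= clamp b x <= b.
Proof.
  intros hb. unfold clamp, Rmax, Rmin. destruct (Rle_dec b x), (Rle_dec (- b) _); lra.
Qed.

Lemma clamp_id b x : - b <= x <= b -> clamp b x = x.
Proof.
  intros hx. unfold clamp. rewrite Rmin_right, Rmax_right; lra.
Qed.

Lemma continuous_clamp b x : continuous (clamp b) x.
Proof.
  apply filterlim_locally. intros eps. exists eps. intros y hy.
  change (Rabs (clamp b y - clamp b x) < eps). change (Rabs (y - x) < eps) in hy.
  apply Rle_lt_trans with (2 := hy). unfold clamp, Rmax, Rmin, Rabs.
  destruct (Rle_dec b x), (Rle_dec b y); repeat destruct (Rle_dec (- b) _);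
  repeat destruct (Rcase_abs _); lra.
Qed.

Definition clamp_point (b : R) (p : R * R) : R * R := (clamp b (fst p), clamp b (snd p)).

Lemma continuous_clamp_point b p : continuous (clamp_point b) p.
Proof.
  destruct p as [x t].
  apply (continuous_comp_2 (fun q : R * R => clamp b (fst q)) (fun q : R * R => clamp b (snd q)) (fun a b => (a, b))).
  - apply (continuous_comp fst (clamp b)); [apply continuous_fst | apply continuous_clamp].
  - apply (continuous_comp snd (clamp b)); [apply continuous_snd | apply continuous_clamp].
  - apply (continuous_ext (fun u : R * R => u)); [now intros [? ?]|]. apply continuous_id.
Qed.

Lemma coefficient_extension_clamp b f f' f'' :
  0 < b -> C2_seg b f f' f'' -> (forall x, seg b x -> f x <> RtoC 0) ->
  coefficient_extension b (fun x => f (clamp b x)) (fun x => f' (clamp b x)).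
Proof.
  intros hb (hf & hf' & _) hf0.
  assert (hcl : forall u, seg b (clamp b u)) by (intros; now apply clamp_bounds).
  split; [|split; [|split]].
  - intros x. apply (continuous_on_retract (seg b)); trivial; [|apply continuous_clamp].
    now apply (is_derive_within_continuous_on _ f f').
  - intros x. apply (continuous_on_retract (seg b)); trivial; [|apply continuous_clamp].
    now apply (is_derive_within_continuous_on _ f' f'').
  - intros x. apply hf0, hcl.
  - intros x hx.
    assert (hloc : locally x (fun y => - b < y < b)) by (apply open_interval, hx).
    apply (is_derive_ext_loc f).
    + generalize hloc. apply filter_imp. intros y hy. rewrite clamp_id; trivial. lra.
    + rewrite clamp_id by lra.
      apply (is_derive_within_interior (seg b)); [apply hf; unfold seg; lra|].
      generalize hloc. apply filter_imp. intros y hy. unfold seg. lra.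
Qed.

Lemma continuous_char_coefficient b f f' r :
  coefficient_extension b f f' -> continuous (char_coefficient f f') r.
Proof.
  intros (hf & hf' & hf0 & _).
  apply continuous_Cmult; [|apply continuous_const].
  assert (h2 : continuous (fun r => r / 2) r).
  { apply (ex_derive_continuous (fun r => r / 2)). auto_derive. easy. }
  apply continuous_Cmult.
  - apply (continuous_comp (fun r => r / 2) f'); trivial.
  - apply (continuous_comp (fun r => r / 2) (fun x => / f x)%C); trivial. now apply continuous_Cinv.
Qed.

(** Because of the clamping every value is already taken on a compact interval. *)
Lemma char_coefficient_bounded b f f' f'' :
  0 < b -> C2_seg b f f' f'' -> (forall x, seg b x -> f x <> RtoC 0) ->
  exists K, 0 < K /\ forall r,
    Cmod (char_coefficient (fun x => f (clamp b x)) (fun x => f' (clamp b x)) r) <= K.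
Proof.
  intros hb hf hf0.
  pose proof (coefficient_extension_clamp b f f' f'' hb hf hf0) as hfe.
  set (G := char_coefficient (fun x => f (clamp b x)) (fun x => f' (clamp b x))).
  destruct (bounded_continuity (V := C_R_NormedModule) G (- (2 * b)) (2 * b)) as [M hM].
  { intros r _. now apply (continuous_char_coefficient b). }
  exists (Rabs M + 1). pose proof (Rabs_pos M). split; [lra|]. intros r.
  assert (hr : G r = G (2 * clamp b (r / 2))).
  { pose proof (clamp_bounds b (r / 2) hb). unfold G, char_coefficient.
    replace (2 * clamp b (r / 2) / 2) with (clamp b (r / 2)) by field.
    now rewrite (clamp_id b (clamp b (r / 2))). }
  rewrite hr. pose proof (clamp_bounds b (r / 2) hb).
  specialize (hM (2 * clamp b (r / 2)) ltac:(lra)). rewrite norm_Cmod in hM.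
  pose proof (Rle_abs M). lra.
Qed.

(** Along a characteristic both x and t vary strictly, so the interior points of a
    segment issued from the diagonal stay in the open square even when its
    endpoint is on the boundary. *)
Lemma char_point_in_open_square b i y z s :
  Rabs y + Rabs z <= 2 * b -> Rmin 0 z < s < Rmax 0 z -> open_square b (char_point i y s).
Proof.
  intros hyz hs.
  assert (h : Rabs y + Rabs s < 2 * b).
  { apply Rlt_le_trans with (2 := hyz). apply Rplus_lt_compat_l.
    unfold Rmin, Rmax in hs. destruct (Rle_dec 0 z); unfold Rabs; destruct (Rcase_abs s), (Rcase_abs z); lra. }
  unfold open_square, char_point; simpl.
  destruct i; unfold sgn; unfold Rabs in h; destruct (Rcase_abs y), (Rcase_abs s); split; lra.
Qed.

Lemma char_point_in_open_strip b i y z s :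
  Rabs (y + z) <= 2 * b -> Rmin (- y) z < s < Rmax (- y) z -> open_strip b (char_point i y s).
Proof.
  intros hyz hs. apply Rabs_le_between in hyz.
  unfold open_strip, char_point; simpl.
  unfold Rmin, Rmax in hs. destruct (Rle_dec (- y) z); lra.
Qed.

(** * Approximation by polynomials in formal powers *)

(** On x = 0 the two components are P + Q at t = y and P - Q at t = - y, where P and Q
    are the parts over 1 and j; solving for P and Q gives the half sum and the
    half difference of the Bernstein polynomials of the data. *)
Lemma approximate_cauchy_data f c (S : bool -> R -> R -> C) (e : R) :
  0 < c -> f 0 = RtoC 1 -> (forall i, jointly_continuous (S i)) -> 0 < e ->
  exists N0 : nat, forall N, (N0 <= N)%nat -> exists a : nat -> B,
    forall i y, Rabs y <= c ->
      Cmod (char_component (Zpoly f a N) i y (- y)%R - S i y (- y)%R)%C <= e.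
Proof.
  intros hc hf hS he.
  set (h1 := fun t => S true t (- t)). set (h2 := fun t => S false (- t) t).
  assert (hopp : forall t, continuous Ropp t).
  { intros t. apply (ex_derive_continuous Ropp). auto_derive. easy. }
  assert (hc1 : forall t, continuous h1 t).
  { intros t. apply (continuous_comp_2 (fun t => t) Ropp (S true)); trivial.
    - apply continuous_id. - apply hS. }
  assert (hc2 : forall t, continuous h2 t).
  { intros t. apply (continuous_comp_2 Ropp (fun t => t) (S false)); trivial.
    - apply continuous_id. - apply hS. }
  destruct (bernstein_approximation c h1 e hc hc1 he) as [N1 hN1].
  destruct (bernstein_approximation c h2 e hc hc2 he) as [N2 hN2].
  exists (max N1 N2). intros N hN.
  pose proof (polynomial_upto_bernstein c h1 N hc) as p1.
  pose proof (polynomial_upto_bernstein c h2 N hc) as p2.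
  destruct (Zpoly_cauchy_data f N
    (fun t => RtoC (/ 2) * bernstein c h1 N t + RtoC (/ 2) * bernstein c h2 N t)%C
    (fun t => RtoC (/ 2) * bernstein c h1 N t + RtoC (- / 2) * bernstein c h2 N t)%C) as [a ha]; trivial.
  { apply polynomial_upto_plus; now apply polynomial_upto_scal. }
  { apply polynomial_upto_plus; now apply polynomial_upto_scal. }
  exists a. intros i y hy. apply Rabs_le_between in hy.
  assert (h12 : (RtoC (/ 2) + RtoC (/ 2) = 1)%C) by (rewrite <- RtoC_plus; f_equal; field).
  unfold char_component, char_point.
  replace ((y + - y) / 2) with 0 by field. rewrite ha. simpl fst. simpl snd.
  rewrite (RtoC_opp (/ 2)).
  destruct i; simpl sgn.
  - replace (1 * (y - - y) / 2) with y by field.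
    specialize (hN1 N ltac:(lia) y hy). unfold h1 in hN1 at 2.
    match goal with |- Cmod ?A <= _ => replace A with
      ((RtoC (/ 2) + RtoC (/ 2)) * bernstein c h1 N y - S true y (- y)%R)%C by ring end.
    rewrite h12, Cmult_1_l. exact hN1.
  - replace (-1 * (y - - y) / 2) with (- y) by field.
    specialize (hN2 N ltac:(lia) (- y) ltac:(lra)). unfold h2 in hN2 at 2.
    rewrite Ropp_involutive in hN2. change (-1) with (- (1)). rewrite RtoC_opp.
    match goal with |- Cmod ?A <= _ => replace A with
      ((RtoC (/ 2) + RtoC (/ 2)) * bernstein c h2 N (- y)%R - S false y (- y)%R)%C by ring end.
    rewrite h12, Cmult_1_l. exact hN2.
Qed.

(** For each N one takes an element that is best possible among the accuracies
    1 / (m + 1) with m <= N. *)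
Lemma diagonal_choice {A : Type} (P : nat -> A -> R -> Prop) (a0 : A) :
  (forall N a e e', e <= e' -> P N a e -> P N a e') ->
  (forall e, 0 < e -> exists N0 : nat, forall N, (N0 <= N)%nat -> exists a, P N a e) ->
  exists a : nat -> A, forall e, 0 < e -> exists N0 : nat, forall N, (N0 <= N)%nat -> P N (a N) e.
Proof.
  intros hmono hex.
  assert (hpos : forall m, 0 < / INR (S m)).
  { intros m. apply Rinv_0_lt_compat, lt_0_INR. lia. }
  assert (hbest : forall N n, exists a, forall m, (m <= n)%nat ->
     (exists a', P N a' (/ INR (S m))) -> P N a (/ INR (S m))).
  { intros N n. induction n as [|n [a IH]].
    - destruct (classic (exists a', P N a' (/ INR 1))) as [[a' h]|h].
      + exists a'. intros m hm _. now replace m with O by lia.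
      + exists a0. intros m hm h'. replace m with O in h' by lia. contradiction.
    - destruct (classic (exists a', P N a' (/ INR (S (S n))))) as [[a' h]|h].
      + exists a'. intros m hm _. apply (hmono N a' (/ INR (S (S n)))); trivial.
        apply Rinv_le_contravar; [apply lt_0_INR; lia | apply le_INR; lia].
      + exists a. intros m hm h'. apply IH; trivial.
        destruct (Nat.eq_dec m (S n)) as [->|]; [contradiction | lia]. }
  destruct (functional_choice _ (fun N => hbest N N)) as [a ha].
  exists a. intros e he.
  destruct (archimed_cor1 e he) as (m & hm & hm0).
  destruct m as [|m]; [lia|].
  destruct (hex (/ INR (S m)) (hpos m)) as [N0 hN0].
  exists (max N0 m). intros N hN.
  apply (hmono N (a N) (/ INR (S m))); [lra|].
  apply ha; [lia|]. apply hN0. lia.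
Qed.

Theorem proposition6p3 (b : R) (f f' f'' : R -> C) (W : R * R -> B)
  (hb : 0 < b)
  (hf : C2_seg b f f' f'')
  (hf_neq0 : forall x, seg b x -> f x <> RtoC 0)
  (hf0 : f 0 = RtoC 1)
  (hW : vekua_solution f f' (open_square b) W)
  (hW_cont : continuous_on (closed_square b) W) :
  exists a : nat -> nat -> B,
    forall eps : R, 0 < eps ->
      exists N0 : nat, forall N : nat, (N0 <= N)%nat ->
        forall z : R * R, closed_square b z ->
          Bnorm (Bminus (Zpoly f (a N) N z) (W z)) < eps.
Proof.
  apply (diagonal_choice (fun N a eps => forall z, closed_square b z ->
    Bnorm (Bminus (Zpoly f a N z) (W z)) < eps) (fun _ => CtoB (RtoC 0))).
  { intros N a e e' hee h z hz. specialize (h z hz). lra. }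
  intros eps heps.
  set (g := fun x => f (clamp b x)). set (g' := fun x => f' (clamp b x)).
  (* Past the square W and f are frozen at the nearest point; this makes
     all the integrands continuous on the whole line. *)
  set (V := fun p => W (clamp_point b p)).
  set (G := char_coefficient g g').
  pose proof (coefficient_extension_clamp b f f' f'' hb hf hf_neq0) as hg. fold g g' in hg.
  destruct (char_coefficient_bounded b f f' f'' hb hf hf_neq0) as (K & hK & hGK).
  fold g g' in hGK. fold G in hGK.
  assert (hG : forall r, continuous G r) by (intros; now apply (continuous_char_coefficient b)).
  assert (hg0 : forall x, g x <> RtoC 0) by apply hg.
  assert (hV : forall p, continuous (U := prod_UniformSpace C_UniformSpace C_UniformSpace) V p).
  { intros p. apply (continuous_on_retract (closed_square b) W (clamp_point b)); trivial.
    - intros u. split; now apply clamp_bounds.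
    - apply continuous_clamp_point. }
  assert (hVv : vekua_solution g g' (open_square b) V).
  { revert hW. apply vekua_solution_ext; [apply open_open_square | |].
    - intros [x t] [hx _]. simpl in *. unfold g, g'. rewrite clamp_id; [easy | lra].
    - intros [x t] [hx ht]. simpl in *. unfold V, clamp_point. simpl. rewrite !clamp_id; [easy | lra | lra]. }
  set (Lam := exp (2 * K * (2 * b))).
  assert (hLam : 1 <= Lam).
  { pose proof (exp_ineq1_le (2 * K * (2 * b))). assert (0 <= 2 * K * (2 * b)) by nra. unfold Lam; lra. }
  (* The errors add up to 7 d Lam at most: 6 d Lam between Zpoly and S, and d
     between S and W. *)
  set (d := eps / (16 * Lam)).
  assert (hd : 0 < d) by (apply Rdiv_lt_0_compat; lra).
  assert (hdL : d * (16 * Lam) = eps) by (unfold d; field; lra).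
  destruct (approximate_goursat_extension G K (2 * b) (char_component V) d) as (S & hS & hres & hVS);
    trivial; try lra.
  { intros i. now apply jointly_continuous_char_component. }
  { intros i y z hyz. apply (vekua_integral_equation g g' (open_square b)); trivial.
    - apply open_open_square.
    - intros s hs. now apply (char_point_in_open_square b i y z). }
  destruct (approximate_cauchy_data g (2 * b) S d) as [N0 hN0]; trivial; try lra.
  { unfold g. rewrite clamp_id; trivial. lra. }
  exists N0. intros N hN. destruct (hN0 N hN) as [a ha].
  exists a. intros [x t] [hx ht]. simpl in hx, ht.
  rewrite (Zpoly_ext b f g) by (trivial; intros u hu; unfold g; now rewrite clamp_id).
  replace (W (x, t)) with (V (x, t)).
  2:{ unfold V, clamp_point. simpl. now rewrite !clamp_id. }
  assert (hZ : forall p, continuous (U := prod_UniformSpace C_UniformSpace C_UniformSpace) (Zpoly g a N) p).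
  { intros p. now apply (continuous_Zpoly b g g'). }
  apply Rle_lt_trans with (7 * d * Lam); [|nra].
  apply Bnorm_char_components. intros i.
  set (y := x + sgn i * t). set (z := x - sgn i * t).
  assert (hyz : Rabs y + Rabs z <= 2 * b).
  { unfold y, z. destruct i; simpl; unfold Rabs;
    repeat destruct (Rcase_abs _); lra. }
  pose proof (Rabs_pos y). pose proof (Rabs_pos z).
  assert (hZS : Cmod (char_component (Zpoly g a N) i y z - S i y z)%C <= 2 * (d + 2 * d) * Lam).
  { apply (cauchy_stability G K (2 * b) S (char_component (Zpoly g a N)) d d); trivial; try lra.
    - intros j. now apply jointly_continuous_char_component.
    - intros j u v hu hv huv. apply (vekua_integral_equation g g' (open_strip b)); trivial.
      + apply open_open_strip.
      + now apply vekua_Zpoly.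
      + intros s hs. now apply (char_point_in_open_strip b j u v).
    - eapply Rle_trans; [apply Rabs_triang | lra]. }
  specialize (hVS i y z hyz).
  replace (char_component (Zpoly g a N) i y z - char_component V i y z)%C with
    ((char_component (Zpoly g a N) i y z - S i y z) + - (char_component V i y z - S i y z))%C by ring.
  eapply Rle_trans; [apply Cmod_triangle|]. rewrite Cmod_opp. nra.
Qed.
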